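(* Let $\Sigma$ be a closed orientable surface of genus $g\ge2$ with a marked point $p$, and consider the Birman exact sequence $$1\to\pi_1(\Sigma,p)\xrightarrow{\ \iota\ }\mathrm{Mod}(\Sigma-p)\to\mathrm{Mod}(\Sigma)\to1.$$ Fix a word metric $d$ on $\mathrm{Mod}(\Sigma-p)$ and an identification $G:\mathbb{H}^2\to\pi_1(\Sigma,p)$ with base-point $x_0$, $G(x_0)=1$. Then there is a number $c>0$ such that almost every geodesic in $\pi_1(\Sigma,p)$, sampled with Lebesgue measure under the identification with $\mathbb{H}^2$, makes linear progress with speed at least $c$ in $d$. That is, for Lebesgue-almost every unit tangent direction at $x_0$, the unit speed hyperbolic geodesic ray $\gamma$ with $\gamma_0=x_0$ in that direction satisfies $$d\big(\iota(G(\gamma_0)),\iota(G(\gamma_T))\big)\ \ge\ c\,T$$ for all $T$ sufficiently large (depending on $\gamma$).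
   Context: $\mathrm{Mod}(\Sigma)$ is the mapping class group of $\Sigma$ and $\mathrm{Mod}(\Sigma-p)$ is the mapping class group of $\Sigma$ punctured/marked at $p$; $\iota$ is the point-pushing homomorphism. Word metrics are with respect to finite generating sets. Fix a hyperbolic metric on $\Sigma$, so that $\pi_1(\Sigma,p)$ acts on the universal cover $\mathbb{H}^2$ by deck transformations. An identification of $\pi_1(\Sigma,p)$ with $\mathbb{H}^2$ is a $\pi_1(\Sigma,p)$-equivariant quasi-isometry $G:\mathbb{H}^2\to\pi_1(\Sigma,p)$, with base-point $x_0$ such that $G(x_0)=1$, chosen once and for all. *)

(* Defs.v *)
From HB Require Import structures.
From mathcomp Require Import all_boot all_order all_algebra generic_quotient.
From mathcomp Require Import all_classical all_reals all_analysis.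
From mathcomp Require Import homotopy.
From mathcomp Require Import lra.
Set Implicit Arguments.
Unset Strict Implicit.
Unset Printing Implicit Defensive.
Import Order.TTheory GRing.Theory Num.Theory.
Import numFieldNormedType.Exports.
Local Open Scope classical_set_scope.
Local Open Scope quotient_scope.
Local Open Scope ring_scope.

Section WordMetric.
Context {G : groupType}.
Implicit Types (A : seq G) (x y : G) (n : nat).

Definition is_word A n x : Prop := exists w : seq G,
  [/\ size w = n, (forall a, a \in w -> (a \in A) || (a^-1%g \in A))
    & x = foldr (fun a b => (a * b)%g) 1%g w].

Definition generates A : Prop := forall x, exists n, is_word A n x.

(* The value 0 off the subgroup generated by [A] is a junk value. *)
Definition word_length A x : nat :=
  if pselect (exists n, `[< is_word A n x >]) is left ex then ex_minn ex
  else 0.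

Definition word_dist (R : realType) A x y : R := (word_length A (x^-1 * y)%g)%:R.

End WordMetric.

Definition quasi_isometry (R : realType) (X Y : Type)
    (dX : X -> X -> R) (dY : Y -> Y -> R) (f : X -> Y) : Prop :=
  exists K C : R, [/\ 1 <= K, 0 <= C,
    forall x x', K^-1 * dX x x' - C <= dY (f x) (f x') <= K * dX x x' + C
  & forall y, exists x, dY y (f x) <= C].

Definition unit_interval (R : realType) : set R := `[0, 1]%classic.
Arguments unit_interval : clear implicits.

Section UnitInterval.
Context {R : realType}.
Local Notation I := (unit_interval R).

Lemma clamp_subproof (t : R) : Num.min 1 (Num.max 0 t) \in I.
Proof.
by rewrite inE /unit_interval/= in_itv/= le_min ler01 le_max lexx/= ge_min lexx.
Qed.

Definition clamp (t : R) : I := exist (fun x => x \in unit_interval R) _ (clamp_subproof t).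

Lemma clampE (t : R) : 0 <= t <= 1 -> set_val (clamp t) = t.
Proof.
move=> /andP[t0 t1]; rewrite set_valE /=.
by rewrite (max_idPr t0) (min_idPr t1).
Qed.

Lemma set_val01 (t : I) : 0 <= set_val t <= 1.
Proof.
by rewrite set_valE; case: t => t /= /set_mem; rewrite /unit_interval /= in_itv.
Qed.

Lemma set_val_clampK (t : I) : clamp (set_val t) = t.
Proof.
have := clampE (set_val01 t); rewrite !set_valE => h.
by apply: val_inj.
Qed.

Lemma continuous_set_val : continuous (set_val : I -> R).
Proof. exact: initial_continuous. Qed.

Lemma continuous_clamp : continuous clamp.
Proof.
apply/continuous_comp_initial => t /=.
apply: (@continuous_min R R (cst 1) (fun t => Num.max 0 t)).
  exact: cvg_cst.
apply: (@continuous_max R R (cst 0) id); first exact: cvg_cst.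
exact: cvg_id.
Qed.

Lemma clamp01_neq : clamp 0 != clamp 1.
Proof.
apply/eqP => /(congr1 set_val); rewrite !clampE ?lexx ?ler01 //.
by move=> /esym/eqP; rewrite oner_eq0.
Qed.

HB.instance Definition _ := @isBiPointed.Build (set_type I) (clamp 0) (clamp 1) clamp01_neq.

Lemma val_zero : set_val (zero : I) = 0.
Proof. by rewrite clampE ?lexx ?ler01. Qed.

Lemma val_one : set_val (one : I) = 1.
Proof. by rewrite clampE ?lexx ?ler01. Qed.

End UnitInterval.

Section FundamentalGroup.
Context {R : realType} {S : topologicalType} (p : S).
Local Notation I := (unit_interval R).

Definition loop := {path (set_type I) from p to p in S}.
Implicit Types a b c : loop.

Definition homotopic a b : Prop := exists H : I * I -> S,
  [/\ continuous H,
    forall t, H (zero, t) = a t /\ H (one, t) = b t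
  & forall s, H (s, zero) = p /\ H (s, one) = p].

Lemma continuous_glue (X Y : topologicalType) (h : X -> R) (f g : X -> Y) :
  continuous h -> continuous f -> continuous g ->
  (forall x, h x = 1/2 -> f x = g x) ->
  continuous (fun x => if h x <= 1/2 then f x else g x).
Proof.
move=> ch cf cg fg x A.
have [hx|hx|hx] := ltgtP (h x) (1/2) => /= nA;
  change (\forall y \near x, A (if h y <= 1/2 then f y else g y)).
- have hn : \forall y \near x, h y < 1/2 by apply: (cvgr_lt (h x)) => //; exact: ch.
  have fn : \forall y \near x, A (f y) := cf x _ nA.
  near=> y; have hy : h y < 1/2 by near: y.
  by rewrite (ltW hy); near: y.
- have hn : \forall y \near x, 1/2 < h y by apply: (cvgr_gt (h x)) => //; exact: ch.
  have gn : \forall y \near x, A (g y) := cg x _ nA.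
  near=> y; have hy : 1/2 < h y by near: y.
  by rewrite leNgt hy /=; near: y.
- have fn : \forall y \near x, A (f y) := cf x _ nA.
  have gn : \forall y \near x, A (g y).
    by apply: (cg x); rewrite -(fg _ hx).
  by near=> y; case: ifP => _; near: y.
Unshelve. all: by end_near.
Qed.

Lemma homotopic_refl a : homotopic a a.
Proof.
exists (a \o snd); split => //=.
  by move=> x; apply: continuous_comp; [exact: cvg_snd|exact: cts_fun].
by move=> s; rewrite path_zero path_one.
Qed.

Lemma continuous_pair (X Y Z : topologicalType) (f : X -> Y) (g : X -> Z) :
  continuous f -> continuous g -> continuous (fun x => (f x, g x)).
Proof. by move=> cf cg x; apply: cvg_pair; [exact: cf|exact: cg]. Qed.

Lemma continuous_compT (X Y Z : topologicalType) (f : X -> Y) (g : Y -> Z) :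
  continuous f -> continuous g -> continuous (fun x => g (f x)).
Proof. by move=> cf cg x; apply: continuous_comp; [exact: cf|exact: cg]. Qed.

Lemma continuous_affine (X : topologicalType) (k l : R) (h : X -> R) :
  continuous h -> continuous (fun x => k + l * h x).
Proof.
move=> ch x; apply: cvgD; first exact: cvg_cst.
by apply: cvgM; [exact: cvg_cst|exact: ch].
Qed.

Lemma continuous_reparam (X : topologicalType) (k l : R) (h : X -> I) :
  continuous h -> continuous (fun x => clamp (k + l * set_val (h x))).
Proof.
move=> ch; apply: (continuous_compT _ continuous_clamp).
exact/continuous_affine/(continuous_compT ch)/continuous_set_val.
Qed.

Lemma continuous_fst (X Y : topologicalType) : continuous (@fst X Y).
Proof. by move=> x; exact: cvg_fst. Qed.

Lemma continuous_snd (X Y : topologicalType) : continuous (@snd X Y).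
Proof. by move=> x; exact: cvg_snd. Qed.

Lemma clamp_le0 (t : R) : t <= 0 -> clamp t = zero.
Proof.
move=> t0; apply: val_inj; rewrite /= (max_idPl t0) (max_idPl _) //.
Qed.

Lemma clamp_ge1 (t : R) : 1 <= t -> clamp t = one.
Proof.
move=> t1; apply: val_inj; rewrite /= (max_idPr _) ?(le_trans ler01) //.
by rewrite (min_idPl t1) (max_idPr ler01) (min_idPl (lexx _)).
Qed.

Lemma homotopic_sym a b : homotopic a b -> homotopic b a.
Proof.
move=> [H [cH Hab Hp]].
exists (fun st => H (clamp (1 + (-1) * set_val st.1), st.2)); split => /=.
- apply: continuous_compT cH; apply: continuous_pair; last exact: continuous_snd.
  exact/continuous_reparam/continuous_fst.
- move=> t; have [<- <-] := Hab t.
  by split; rewrite ?val_zero ?val_one ?mulN1r ?oppr0 ?addr0 ?subrr.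
- by move=> s; exact: Hp.
Qed.

Lemma homotopic_trans b a c : homotopic a b -> homotopic b c -> homotopic a c.
Proof.
move=> [H [cH Hab Hp]] [K [cK Kbc Kp]].
exists (fun st => if set_val st.1 <= 1/2
                  then H (clamp (0 + 2 * set_val st.1), st.2)
                  else K (clamp (-1 + 2 * set_val st.1), st.2)); split.
- apply: (continuous_glue (h := fun st : I * I => set_val st.1)).
  + exact: continuous_compT (@continuous_fst _ _) continuous_set_val.
  + apply: continuous_compT cH; apply: continuous_pair; last exact: continuous_snd.
    exact/continuous_reparam/continuous_fst.
  + apply: continuous_compT cK; apply: continuous_pair; last exact: continuous_snd.
    exact/continuous_reparam/continuous_fst.
  + move=> [s t] /= ->; rewrite clamp_ge1; last lra.
    rewrite clamp_le0; last lra.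
    by rewrite (Hab t).2 (Kbc t).1.
- move=> t /=; rewrite val_zero val_one; split.
  + by rewrite ifT ?clamp_le0 ?(Hab t).1//; lra.
  + by rewrite ifF ?clamp_ge1 ?(Kbc t).2//; lra.
- by move=> s /=; case: ifP => _; rewrite ?(Hp _).1 ?(Hp _).2 ?(Kp _).1 ?(Kp _).2.
Qed.

Definition homotopicb a b : bool := `[< homotopic a b >].

Lemma homotopicb_refl : reflexive homotopicb.
Proof. by move=> a; apply/asboolP; exact: homotopic_refl. Qed.

Lemma homotopicb_sym : symmetric homotopicb.
Proof.
by move=> a b; apply: asbool_equiv_eq; split; exact: homotopic_sym.
Qed.

Lemma homotopicb_trans : transitive homotopicb.
Proof.
move=> b a c /asboolP ab /asboolP bc; apply/asboolP.
exact: homotopic_trans bc.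
Qed.

Definition homotopic_equiv :=
  EquivRel homotopicb homotopicb_refl homotopicb_sym homotopicb_trans.

Definition pi1 : Type := {eq_quot homotopic_equiv}.

HB.instance Definition _ := Choice.on pi1.
HB.instance Definition _ := EqQuotient.on pi1.

Lemma pi1_eqP a b : \pi_pi1 a = \pi_pi1 b <-> homotopic a b.
Proof.
split=> [/eqquotP/asboolP //|ab]; apply/eqquotP; exact/asboolP.
Qed.

Definition loop_one : loop := [the {path (set_type I) from p to p in S} of cst p].

(* [concat a b] runs through [a] first, then through [b]. *)
Definition concat_fun a b (t : I) : S :=
  if set_val t <= 1/2 then a (clamp (0 + 2 * set_val t))
  else b (clamp (-1 + 2 * set_val t)).

Lemma concat_continuous a b : continuous (concat_fun a b).
Proof.
apply: continuous_glue; first exact: continuous_set_val.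
- apply: (continuous_compT _ (@cts_fun _ _ a)).
  by apply: (continuous_reparam (h := id)) => x; exact: cvg_id.
- apply: (continuous_compT _ (@cts_fun _ _ b)).
  by apply: (continuous_reparam (h := id)) => x; exact: cvg_id.
- move=> t ->; rewrite clamp_ge1 ?clamp_le0 ?path_one ?path_zero//; lra.
Qed.

Lemma concat_zero a b : concat_fun a b zero = p.
Proof. by rewrite /concat_fun val_zero ifT ?clamp_le0 ?path_zero//; lra. Qed.

Lemma concat_one a b : concat_fun a b one = p.
Proof. by rewrite /concat_fun val_one ifF ?clamp_ge1 ?path_one//; lra. Qed.

Definition concat a b : loop :=
  mk_path (@concat_continuous a b) (concat_zero a b) (concat_one a b).

Definition rev_fun a (t : I) : S := a (clamp (1 + (-1) * set_val t)).

Lemma rev_continuous a : continuous (rev_fun a).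
Proof.
apply: (continuous_compT _ (@cts_fun _ _ a)).
by apply: (continuous_reparam (h := id)) => x; exact: cvg_id.
Qed.

Lemma rev_zero a : rev_fun a zero = p.
Proof. by rewrite /rev_fun val_zero clamp_ge1 ?path_one//; lra. Qed.

Lemma rev_one a : rev_fun a one = p.
Proof. by rewrite /rev_fun val_one clamp_le0 ?path_zero//; lra. Qed.

Definition rev_loop a : loop :=
  mk_path (@rev_continuous a) (rev_zero a) (rev_one a).

Lemma concat_homotopic a a' b b' :
  homotopic a a' -> homotopic b b' -> homotopic (concat a b) (concat a' b').
Proof.
move=> [H [cH Ha Hp]] [K [cK Kb Kp]].
exists (fun st => if set_val st.2 <= 1/2
                  then H (st.1, clamp (0 + 2 * set_val st.2))
                  else K (st.1, clamp (-1 + 2 * set_val st.2))); split.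
- apply: (continuous_glue (h := fun st : I * I => set_val st.2)).
  + exact: continuous_compT (@continuous_snd _ _) continuous_set_val.
  + apply: continuous_compT cH; apply: continuous_pair; first exact: continuous_fst.
    exact/continuous_reparam/continuous_snd.
  + apply: continuous_compT cK; apply: continuous_pair; first exact: continuous_fst.
    exact/continuous_reparam/continuous_snd.
  + move=> [s t] /= ->; rewrite clamp_ge1; last lra.
    rewrite clamp_le0; last lra.
    by rewrite (Hp s).2 (Kp s).1.
- move=> t /=; rewrite /mk_path /concat_fun.
  by case: ifP => _; rewrite ?(Ha _).1 ?(Ha _).2 ?(Kb _).1 ?(Kb _).2.
- move=> s /=; rewrite val_zero val_one; split.
  + by rewrite ifT ?clamp_le0 ?(Hp s).1//; lra.
  + by rewrite ifF ?clamp_ge1 ?(Kp s).2//; lra.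
Qed.

Lemma rev_homotopic a b : homotopic a b -> homotopic (rev_loop a) (rev_loop b).
Proof.
move=> [H [cH Hab Hp]].
exists (fun st => H (st.1, clamp (1 + (-1) * set_val st.2))); split => /=.
- apply: continuous_compT cH; apply: continuous_pair; first exact: continuous_fst.
  exact/continuous_reparam/continuous_snd.
- by move=> t; exact: Hab.
- move=> s; rewrite val_zero val_one.
  by rewrite clamp_ge1 ?clamp_le0 ?(Hp s).1 ?(Hp s).2//; lra.
Qed.

Lemma reparam_homotopic (f : R -> S) (u v : R -> R) a b :
  continuous f -> continuous u -> continuous v ->
  (forall t : I, a t = f (u (set_val t))) ->
  (forall t : I, b t = f (v (set_val t))) ->
  (forall s, 0 <= s <= 1 -> f (u 0 + s * (v 0 - u 0)) = p) ->
  (forall s, 0 <= s <= 1 -> f (u 1 + s * (v 1 - u 1)) = p) ->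
  homotopic a b.
Proof.
move=> cf cu cv fa fb f0 f1.
pose val2 (st : I * I) : R := set_val st.2.
have cval2 : continuous val2.
  exact: continuous_compT (@continuous_snd _ _) continuous_set_val.
have cval1 : continuous (fun st : I * I => set_val st.1 : R).
  exact: continuous_compT (@continuous_fst _ _) continuous_set_val.
exists (fun st => f (u (val2 st) + set_val st.1 * (v (val2 st) - u (val2 st)))).
split.
- apply: continuous_compT cf => x; apply: cvgD.
    by apply: continuous_comp; [exact: cval2|exact: cu].
  apply: cvgM; first exact: cval1.
  apply: cvgB; apply: continuous_comp; first [exact: cval2|exact: cu|exact: cv].
- move=> t; rewrite /val2 /= val_zero val_one mul0r addr0 mul1r addrC subrK.
  by rewrite -fa -fb.
- move=> s; rewrite /val2 /= val_zero val_one.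
  by split; [apply: f0|apply: f1]; exact: set_val01.
Qed.

Definition extend a (t : R) : S := a (clamp t).

Lemma extend_continuous a : continuous (extend a).
Proof. exact: (continuous_compT continuous_clamp (@cts_fun _ _ a)). Qed.

Lemma extend_le0 a t : t <= 0 -> extend a t = p.
Proof. by move=> t0; rewrite /extend clamp_le0 // path_zero. Qed.

Lemma extend_ge1 a t : 1 <= t -> extend a t = p.
Proof. by move=> t0; rewrite /extend clamp_ge1 // path_one. Qed.

Lemma extend_val a (t : I) : a t = extend a (set_val t).
Proof. by rewrite /extend set_val_clampK. Qed.

Lemma continuous_affine_id (k l : R) : continuous (fun t : R => k + l * t).
Proof. by apply: continuous_affine => x; exact: cvg_id. Qed.

Lemma continuous_idR : continuous (fun t : R => t).
Proof. by move=> x; exact: cvg_id. Qed.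

Lemma continuous_minR (f g : R -> R) :
  continuous f -> continuous g -> continuous (fun t => Num.min (f t) (g t)).
Proof. by move=> cf cg x; apply: (@continuous_min R R f g x (cf x) (cg x)). Qed.

Lemma concat1l a : homotopic (concat loop_one a) a.
Proof.
apply: (reparam_homotopic (@extend_continuous a)
          (@continuous_affine_id (-1) 2) continuous_idR).
- move=> t; rewrite /concat /= /mk_path /concat_fun /=; case: ifP => // h.
  by rewrite extend_le0//; lra.
- exact: extend_val.
- by move=> s s01; apply: extend_le0; nra.
- by move=> s s01; apply: extend_ge1; nra.
Qed.

Lemma concat1r a : homotopic (concat a loop_one) a.
Proof.
apply: (reparam_homotopic (@extend_continuous a)
          (@continuous_affine_id 0 2) continuous_idR).
- move=> t; rewrite /concat /= /mk_path /concat_fun /=; case: ifPn => // h.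
  by rewrite extend_ge1//; lra.
- exact: extend_val.
- by move=> s s01; apply: extend_le0; nra.
- by move=> s s01; apply: extend_ge1; nra.
Qed.

Lemma concatVr a : homotopic (concat a (rev_loop a)) loop_one.
Proof.
apply: (reparam_homotopic (@extend_continuous a)
  (continuous_minR (@continuous_affine_id 0 2) (@continuous_affine_id 2 (-2)))
  (@continuous_affine_id 0 0)).
- move=> t; rewrite /concat /= /mk_path /concat_fun /= /rev_loop /= /mk_path.
  rewrite /rev_fun; have := set_val01 t; set x := set_val t => x01.
  case: ifPn => h.
    by rewrite min_l //; lra.
  rewrite min_r; last lra.
  rewrite clampE; last lra.
  by rewrite /extend; congr (a (clamp _)); lra.
- by move=> t; rewrite extend_le0 //; lra.
- by move=> s s01; apply: extend_le0; rewrite min_l; nra.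
- by move=> s s01; apply: extend_le0; rewrite min_r; nra.
Qed.

Lemma rev_loopK a : rev_loop (rev_loop a) = a.
Proof.
apply/path_eqP => t; rewrite /rev_loop /= /mk_path /rev_fun /= /mk_path /rev_fun.
have := set_val01 t => t01; rewrite clampE; last lra.
by rewrite (_ : 1 + _ = set_val t) ?set_val_clampK //; lra.
Qed.

Lemma concatVl a : homotopic (concat (rev_loop a) a) loop_one.
Proof. by have := concatVr (rev_loop a); rewrite rev_loopK. Qed.

Lemma concatA a b c :
  homotopic (concat a (concat b c)) (concat (concat a b) c).
Proof.
apply: homotopic_sym.
apply: (reparam_homotopic
  (@extend_continuous (concat a (concat b c)))
  (continuous_minR (@continuous_affine_id 0 2)
     (continuous_minR (@continuous_affine_id (1/4) 1)
        (@continuous_affine_id (1/2) (1/2)))) continuous_idR).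
- move=> t; rewrite /extend /concat /= /mk_path /concat_fun /= /mk_path.
  rewrite /concat_fun; have := set_val01 t; set x := set_val t => x01.
  have [h1|h1] := leP x (1/4).
    rewrite (min_l (y := Num.min _ _)); last first.
      by rewrite le_min; apply/andP; split; lra.
    rewrite (@clampE _ (0 + 2 * x)); last lra.
    rewrite (_ : x <= 1/2); last lra.
    by rewrite (_ : 0 + 2 * x <= 1/2); last lra.
  have [h2|h2] := leP x (1/2).
    rewrite (min_r (x := 0 + 2 * x)); last first.
      by rewrite ge_min; apply/orP; left; lra.
    rewrite min_l; last lra.
    rewrite (@clampE _ (0 + 2 * x)); last lra.
    rewrite (@clampE _ (1/4 + 1 * x)); last lra.
    rewrite (@clampE _ (-1 + 2 * (1/4 + 1 * x))); last lra.
    rewrite [0 + 2 * x <= 1/2](_ : _ = false); last lra.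
    rewrite [1/4 + 1 * x <= 1/2](_ : _ = false); last lra.
    rewrite (_ : -1 + 2 * (1/4 + 1 * x) <= 1/2); last lra.
    by congr (b (clamp _)); lra.
  rewrite (min_r (x := 0 + 2 * x)); last first.
    by rewrite ge_min; apply/orP; right; lra.
  rewrite min_r; last lra.
  rewrite (@clampE _ (1/2 + 1/2 * x)); last lra.
  rewrite (@clampE _ (-1 + 2 * (1/2 + 1/2 * x))); last lra.
  rewrite [1/2 + 1/2 * x <= 1/2](_ : _ = false); last lra.
  rewrite [-1 + 2 * (1/2 + 1/2 * x) <= 1/2](_ : _ = false); last lra.
  by congr (c (clamp _)); lra.
- exact: extend_val.
- move=> s s01; apply: extend_le0.
  rewrite (min_l (y := Num.min _ _)); last by rewrite le_min; apply/andP; split; lra.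
  by lra.
- move=> s s01; apply: extend_ge1.
  rewrite (min_r (x := 0 + 2 * 1)); last by rewrite ge_min; apply/orP; first [left; lra|right; lra].
  by rewrite min_r; nra.
Qed.

Definition pi1_one : pi1 := \pi_pi1 loop_one.
Definition pi1_mul (x y : pi1) : pi1 := \pi_pi1 (concat (repr x) (repr y)).
Definition pi1_inv (x : pi1) : pi1 := \pi_pi1 (rev_loop (repr x)).

Lemma homotopic_repr a : homotopic (repr (\pi_pi1 a)) a.
Proof. by apply/pi1_eqP; rewrite reprK. Qed.

Lemma pi1_mulE a b : pi1_mul (\pi_pi1 a) (\pi_pi1 b) = \pi_pi1 (concat a b).
Proof. by apply/pi1_eqP/concat_homotopic; exact: homotopic_repr. Qed.

Lemma pi1_invE a : pi1_inv (\pi_pi1 a) = \pi_pi1 (rev_loop a).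
Proof. by apply/pi1_eqP/rev_homotopic; exact: homotopic_repr. Qed.

Fact pi1_mulA : associative pi1_mul.
Proof.
elim/quotW=> a; elim/quotW=> b; elim/quotW=> c.
rewrite (pi1_mulE b c) (pi1_mulE a b) (pi1_mulE a) (pi1_mulE _ c).
by apply/pi1_eqP; exact: concatA.
Qed.

Fact pi1_mul1g : left_id pi1_one pi1_mul.
Proof.
by elim/quotW=> a; rewrite pi1_mulE; apply/pi1_eqP; exact: concat1l.
Qed.

Fact pi1_mulg1 : right_id pi1_one pi1_mul.
Proof.
by elim/quotW=> a; rewrite pi1_mulE; apply/pi1_eqP; exact: concat1r.
Qed.

Fact pi1_mulVg : left_inverse pi1_one pi1_inv pi1_mul.
Proof.
elim/quotW=> a; rewrite pi1_invE pi1_mulE.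
by apply/pi1_eqP; exact: concatVl.
Qed.

Fact pi1_mulgV : right_inverse pi1_one pi1_inv pi1_mul.
Proof.
elim/quotW=> a; rewrite pi1_invE pi1_mulE.
by apply/pi1_eqP; exact: concatVr.
Qed.

HB.instance Definition _ := isGroup.Build pi1
  pi1_mulA pi1_mul1g pi1_mulg1 pi1_mulVg pi1_mulgV.

End FundamentalGroup.
Arguments loop R {S} p.
Arguments pi1 R {S} p.

Section Surfaces.
Context {R : realType} {S : topologicalType}.
Local Notation I := (unit_interval R).

Definition open_embedding (e : R * R -> S) : Prop :=
  [/\ continuous e, injective e & forall U, open U -> open (e @` U)].

Definition polar (z : R * R) (r t : R) : R * R :=
  (z.1 + r * cos t, z.2 + r * sin t).

(* The transition map [e2^-1 \o e1] has local degree 1 wherever it is defined: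
   the image of every small circle about [z], written in polar coordinates
   about the image [w] of [z], winds once around [w] in the positive sense. *)
Definition same_orientation (e1 e2 : R * R -> S) : Prop :=
  forall z w, e1 z = e2 w -> \forall r \near 0^'+,
    exists rho theta : R -> R, [/\ continuous rho, continuous theta,
      forall t, 0 < rho t,
      forall t, e1 (polar z r t) = e2 (polar w (rho t) (theta t))
    & theta (2 * pi) = theta 0 + 2 * pi].

(* An orientation of a surface, given as a maximal oriented atlas: the
   parametrized discs that are declared to be positive. *)
Definition orientation (O : set (R * R -> S)) : Prop :=
  [/\ O `<=` open_embedding,
    forall e1 e2, O e1 -> O e2 -> same_orientation e1 e2,
    forall x, exists2 e, O e & range e x
  & forall e, open_embedding e ->
      (forall e', O e' -> same_orientation e e' /\ same_orientation e' e) ->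
      O e].

(* Being locally Euclidean without boundary, and orientable, is part of
   [orientation O]; second countability follows from compactness. *)
Definition closed_oriented_surface (O : set (R * R -> S)) : Prop :=
  [/\ orientation O, hausdorff_space S, compact [set: S] & connected [set: S]].

Definition simple_closed_curve (C : set S) : Prop :=
  exists c : I -> S, [/\ continuous c, c zero = c one,
    forall s t, c s = c t ->
      [\/ s = t, s = zero /\ t = one | s = one /\ t = zero]
  & range c = C].

Definition nonseparating_curves (n : nat) : Prop :=
  exists C : 'I_n -> set S, [/\ forall i, simple_closed_curve (C i),
    trivIset [set: 'I_n] C & connected (~` \bigcup_i C i)].

(* The genus of a connected closed orientable surface: the maximal number of
   disjoint simple closed curves that do not jointly separate it. *)
Definition has_genus (g : nat) : Prop :=
  nonseparating_curves g /\ forall n, nonseparating_curves n -> (n <= g)%N.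

End Surfaces.

Section MappingClassGroup.
Context {R : realType} {S : topologicalType}.
(* Orientation-preserving homeomorphisms fixing every point of [P]: the cases
   of interest are [P = set0] and [P = [set p]]. *)
Variables (O : set (R * R -> S)) (P : set S).
Local Notation I := (unit_interval R).

Record homeo := Homeo {
  homeo_fun :> S -> S;
  homeo_inv : S -> S;
  homeo_funK : cancel homeo_fun homeo_inv;
  homeo_invK : cancel homeo_inv homeo_fun;
  homeo_continuous : continuous homeo_fun;
  homeo_inv_continuous : continuous homeo_inv;
  homeo_fix : forall x, P x -> homeo_fun x = x;
  homeo_orient : forall e, O (homeo_fun \o e) <-> O e }.

HB.instance Definition _ := gen_eqMixin homeo.
HB.instance Definition _ := gen_choiceMixin homeo.

Implicit Types f g h : homeo.

Definition homeo1 : homeo.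
Proof. by exists id id => // x; exact: cvg_id. Defined.

Definition homeoM f g : homeo.
Proof.
exists (f \o g) (homeo_inv g \o homeo_inv f).
- exact: can_comp (@homeo_funK f) (@homeo_funK g).
- exact: can_comp (@homeo_invK g) (@homeo_invK f).
- exact: continuous_compT (@homeo_continuous g) (@homeo_continuous f).
- exact: continuous_compT (@homeo_inv_continuous f) (@homeo_inv_continuous g).
- by move=> x Px; rewrite /= !homeo_fix.
- move=> e; split.
    by move=> /(homeo_orient f (g \o e)) /homeo_orient.
  by move=> /(homeo_orient g) /(homeo_orient f).
Defined.

Definition homeoV f : homeo.
Proof.
exists (homeo_inv f) f.
- exact: homeo_invK.
- exact: homeo_funK.
- exact: homeo_inv_continuous.
- exact: homeo_continuous.
- by move=> x Px; rewrite -{1}(homeo_fix f Px) homeo_funK.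
- move=> e; rewrite -(homeo_orient f).
  by rewrite (_ : f \o (homeo_inv f \o e) = e) //; apply/funext => z /=;
    rewrite homeo_invK.
Defined.

Definition isotopy (F : I -> homeo) : Prop :=
  continuous (fun tx : I * S => F tx.1 tx.2).

Definition isotopic f g : Prop :=
  exists F : I -> homeo, [/\ isotopy F, F zero =1 f & F one =1 g].

Lemma eq_isotopic f g : f =1 g -> isotopic f g.
Proof.
move=> fg; exists (fun=> f); split => //.
exact: continuous_compT (@continuous_snd _ _) (@homeo_continuous f).
Qed.

Lemma isotopicM f f' g g' :
  isotopic f f' -> isotopic g g' -> isotopic (homeoM f g) (homeoM f' g').
Proof.
move=> [F [cF F0 F1]] [G [cG G0 G1]]; exists (fun t => homeoM (F t) (G t)).
split => [|x|x] /=; last 2 first.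
- by rewrite F0 G0.
- by rewrite F1 G1.
exact: continuous_compT (continuous_pair (@continuous_fst _ _) cG) cF.
Qed.

Lemma isotopic_sym f g : isotopic f g -> isotopic g f.
Proof.
move=> [F [cF F0 F1]].
exists (fun t => F (clamp (1 + (-1) * set_val t))); split.
- exact: continuous_compT (continuous_pair
    (@continuous_reparam _ _ 1 (-1) _ (@continuous_fst _ _))
    (@continuous_snd _ _)) cF.
- by move=> x; rewrite val_zero clamp_ge1 ?F1//; lra.
- by move=> x; rewrite val_one clamp_le0 ?F0//; lra.
Qed.

Lemma isotopic_trans g f h : isotopic f g -> isotopic g h -> isotopic f h.
Proof.
move=> [F [cF F0 F1]] [G [cG G0 G1]].
exists (fun t => homeoM (F t) (homeoM (homeoV g) (G t))).
split => [|x|x] /=; last 2 first.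
- by rewrite F0 G0 homeo_funK.
- by rewrite F1 G1 homeo_invK.
exact: continuous_compT (continuous_pair (@continuous_fst _ _)
  (continuous_compT cG (@homeo_inv_continuous g))) cF.
Qed.

Lemma isotopicV f g : isotopic f g -> isotopic (homeoV f) (homeoV g).
Proof.
move=> /isotopic_sym [F [cF F0 F1]].
exists (fun t => homeoM (homeoV g) (homeoM (F t) (homeoV f))).
split => [|x|x] /=; last 2 first.
- by rewrite F0 homeo_funK.
- by rewrite F1 homeo_invK.
have cf : continuous (fun tx : I * S => homeo_inv f tx.2).
  exact: continuous_compT (@continuous_snd _ _) (@homeo_inv_continuous f).
exact: continuous_compT (continuous_compT
  (continuous_pair (@continuous_fst _ _) cf) cF) (@homeo_inv_continuous g).
Qed.

Definition isotopicb f g : bool := `[< isotopic f g >].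

Lemma isotopicb_refl : reflexive isotopicb.
Proof. by move=> f; apply/asboolP/eq_isotopic. Qed.

Lemma isotopicb_sym : symmetric isotopicb.
Proof. by move=> f g; apply: asbool_equiv_eq; split; exact: isotopic_sym. Qed.

Lemma isotopicb_trans : transitive isotopicb.
Proof.
by move=> g f h /asboolP fg /asboolP gh; apply/asboolP; exact: isotopic_trans gh.
Qed.

Definition isotopic_equiv :=
  EquivRel isotopicb isotopicb_refl isotopicb_sym isotopicb_trans.

Definition mcg : Type := {eq_quot isotopic_equiv}.

HB.instance Definition _ := Choice.on mcg.
HB.instance Definition _ := EqQuotient.on mcg.

Lemma mcg_eqP f g : \pi_mcg f = \pi_mcg g <-> isotopic f g.
Proof. by split=> [/eqquotP/asboolP //|fg]; apply/eqquotP; exact/asboolP. Qed.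

Definition mcg_one : mcg := \pi_mcg homeo1.
Definition mcg_mul (x y : mcg) : mcg := \pi_mcg (homeoM (repr x) (repr y)).
Definition mcg_inv (x : mcg) : mcg := \pi_mcg (homeoV (repr x)).

Lemma isotopic_repr f : isotopic (repr (\pi_mcg f)) f.
Proof. by apply/mcg_eqP; rewrite reprK. Qed.

Lemma mcg_mulE f g : mcg_mul (\pi_mcg f) (\pi_mcg g) = \pi_mcg (homeoM f g).
Proof. by apply/mcg_eqP/isotopicM; exact: isotopic_repr. Qed.

Lemma mcg_invE f : mcg_inv (\pi_mcg f) = \pi_mcg (homeoV f).
Proof. by apply/mcg_eqP/isotopicV; exact: isotopic_repr. Qed.

Fact mcg_mulA : associative mcg_mul.
Proof.
elim/quotW=> f; elim/quotW=> g; elim/quotW=> h.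
rewrite (mcg_mulE g h) (mcg_mulE f g) (mcg_mulE f) (mcg_mulE _ h).
by apply/mcg_eqP/eq_isotopic.
Qed.

Fact mcg_mul1g : left_id mcg_one mcg_mul.
Proof. by elim/quotW=> f; rewrite mcg_mulE; apply/mcg_eqP/eq_isotopic. Qed.

Fact mcg_mulg1 : right_id mcg_one mcg_mul.
Proof. by elim/quotW=> f; rewrite mcg_mulE; apply/mcg_eqP/eq_isotopic. Qed.

Fact mcg_mulVg : left_inverse mcg_one mcg_inv mcg_mul.
Proof.
elim/quotW=> f; rewrite mcg_invE mcg_mulE; apply/mcg_eqP/eq_isotopic => x /=.
exact: homeo_funK.
Qed.

Fact mcg_mulgV : right_inverse mcg_one mcg_inv mcg_mul.
Proof.
elim/quotW=> f; rewrite mcg_invE mcg_mulE; apply/mcg_eqP/eq_isotopic => x /=.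
exact: homeo_invK.
Qed.

HB.instance Definition _ := isGroup.Build mcg
  mcg_mulA mcg_mul1g mcg_mulg1 mcg_mulVg mcg_mulgV.

End MappingClassGroup.

(* [point_push O a m]: the class [m] is obtained by dragging [p] along [a].
   With products of loops read from left to right and mapping classes composed
   from right to left, a homomorphism is obtained by letting the isotopy run
   from the homeomorphism to the identity (equivalently, by dragging [p] along
   the reverse of [a], starting from the identity). *)
Definition point_push (R : realType) (S : topologicalType) (p : S)
    (O : set (R * R -> S)) (a : loop R p) (m : mcg O [set p]) : Prop :=
  exists f : homeo O [set p], \pi_(mcg O [set p]) f = m /\
  exists F : unit_interval R -> homeo O set0,
    [/\ isotopy F, F zero =1 f, F one =1 id & forall t, F t p = a t].

Definition point_pushing (R : realType) (S : topologicalType) (p : S)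
    (O : set (R * R -> S)) (iota : pi1 R p -> mcg O [set p]) : Prop :=
  forall a : loop R p, point_push a (iota (\pi_(pi1 R p) a)).

Section HyperbolicPlane.
Context {R : realType}.

Definition upper_half_plane : set (R * R) := [set z | 0 < z.2].

Local Notation H2 := (set_type upper_half_plane).

Definition arcosh (u : R) : R := ln (u + Num.sqrt (u ^+ 2 - 1)).

Definition hyp_dist (z w : H2) : R :=
  let: (x, y) := set_val z in let: (x', y') := set_val w in
  arcosh (1 + ((x - x') ^+ 2 + (y - y') ^+ 2) / (2 * y * y')).

(* The unit speed geodesic ray starting at [x0] in the direction [theta]; the
   half-plane model is conformal, so that [theta] is the Riemannian angle, and
   unit vectors at [x0] have Euclidean length [(set_val x0).2]. *)
Definition geodesic_ray (x0 : H2) (theta : R) (gamma : R -> H2) : Prop :=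
  [/\ gamma 0 = x0,
    forall s t, 0 <= s -> 0 <= t -> hyp_dist (gamma s) (gamma t) = `|s - t|,
    (fun t => ((set_val (gamma t)).1 - (set_val x0).1) / t) @ 0^'+ -->
      (set_val x0).2 * cos theta
  & (fun t => ((set_val (gamma t)).2 - (set_val x0).2) / t) @ 0^'+ -->
      (set_val x0).2 * sin theta].

Context {S : topologicalType}.

Definition covering_map (X Y : topologicalType) (q : X -> Y) : Prop :=
  [/\ continuous q, forall U, open U -> open (q @` U), range q = [set: Y]
  & forall y, exists2 U, open_nbhs y U & exists V : set (set X),
      [/\ trivIset V id, forall W, V W -> open W /\ set_bij W U q
        & q @^-1` U = \bigcup_(W in V) W]].

Definition deck_transformation (q : H2 -> S) (D : H2 -> H2) : Prop :=
  [/\ continuous D,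
      exists D' : H2 -> H2, [/\ continuous D', cancel D D' & cancel D' D]
    & q \o D = q].

(* A hyperbolic metric on [S], given by its universal covering. *)
Definition hyperbolic_structure (q : H2 -> S) : Prop :=
  covering_map q /\
  forall D, deck_transformation q D ->
    forall z w, hyp_dist (D z) (D w) = hyp_dist z w.

(* [D] is the deck transformation by which [a] acts, for the lift [pt] of the
   base-point [p]: it moves [pt] to the end of the lift from [pt] of a loop
   representing [a]. *)
Definition deck_action (p : S) (q : H2 -> S) (pt : H2) (a : pi1 R p)
    (D : H2 -> H2) : Prop :=
  deck_transformation q D /\
  exists2 l : unit_interval R -> H2,
    continuous l /\ (l zero = pt /\ l one = D pt)
  & exists2 b : loop R p, \pi_(pi1 R p) b = a & q \o l = b.

Definition deck_equivariant (p : S) (q : H2 -> S) (pt : H2)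
    (G : H2 -> pi1 R p) : Prop :=
  forall a D, deck_action q pt a D -> forall z, G (D z) = (a * G z)%g.

End HyperbolicPlane.
Arguments upper_half_plane : clear implicits.

(* Main.v *)
Require Import Defs.
From mathcomp Require Import all_boot all_order all_algebra generic_quotient.
From mathcomp Require Import all_classical all_reals all_analysis.
From mathcomp Require Import homotopy ring lra.
Import Order.TTheory GRing.Theory Num.Theory.
Import numFieldNormedType.Exports.
Local Open Scope classical_set_scope.
Local Open Scope ring_scope.

Set Implicit Arguments.
Unset Strict Implicit.
Unset Printing Implicit Defensive.

(** The proof is a count of mapping classes against an estimate of angles.

    A ball of radius [k] in the mapping class group has at most [N ^ k]
    elements, where [N] depends only on the generating set [A]
    ([size_words]); for [k = n / N] this is at most [2 ^ n].  On the other
    hand, point-pushing is injective, and [G] is a quasi-isometry, so a given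
    mapping class [m] is the image of [G z] only for [z] in one set of
    diameter at most some constant [M].  Seen from [x0], such a set at
    distance [n] or more subtends an angle of order [expR (- n)]
    ([ray_angle_close]): this is the exponential divergence of hyperbolic
    geodesics.  So the directions whose ray is, at some time between [n] and
    [n + 1], sent into the ball of radius [n / N] have measure of order
    [(2 / expR 1) ^ n].  This is summable because [2 < expR 1], and the
    Borel-Cantelli lemma says that almost every direction is of this kind for
    finitely many [n] only, which is linear progress with speed [1 / N].

    The exponential distortion of the surface group in the mapping class group
    is thus harmless: there are too few short mapping classes to catch more
    than a null set of rays.

    Injectivity of point-pushing ([point_pushing_central], [center_trivial])
    goes as follows.  The push along [a] acts on the fundamental group by
    conjugation by [a], because the isotopy that drags the base-point along [a]
    sweeps out, for each loop [l], a square with sides [f \o l], [a], [a], [l].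
    If two loops give the same mapping class they therefore differ by a central
    element [c].  The deck transformation by which [c] acts is at bounded
    distance from the identity, since [G (D z) = c * G z] and left translation
    by a central element moves every element by the same word length.  But the
    identity is the only isometry of the hyperbolic plane at bounded distance
    from the identity ([bounded_displacement_id]), so [c = 1].

    The deck transformation of [c] is obtained by lifting the covering [q]
    through itself along Euclidean segments, the half-plane being convex
    ([exists_deck_action]). *)

(** * Lifting paths and their families through a covering map *)

Section RealInduction.
Context {R : realType}.

(** Connectedness of the line, in the form that extension arguments along paths
    use: a property that propagates locally in both directions holds everywhere.
    No compactness is involved, so that paths need not be subdivided. *)
Lemma real_induction (P : R -> Prop) (a : R) :
  (forall t : R, exists2 J : set R, nbhs t J & forall s s', J s -> J s' -> P s -> P s') ->
  P a -> forall t, P t.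
Proof.
move=> step Pa t.
have PT : P = [set: R].
  have cR : connected [set: R] by apply/connected_intervalP.
  apply: cR; first by exists a.
  - exists P; rewrite ?setTI// openE => s Ps.
    have [J nJ JP] := step s; near=> s'.
    by apply: (JP s s') => //; [exact: nbhs_singleton|near: s'].
  - exists P; rewrite ?setTI// -openC openE => s nPs.
    have [J nJ JP] := step s; near=> s'.
    move=> Ps'; apply: nPs.
    by apply: (JP s' s) => //; [near: s'|exact: nbhs_singleton].
by rewrite PT.
Unshelve. all: by end_near. Qed.

End RealInduction.

Section Covering.
Context {R : realType} {X Y : topologicalType} (q : X -> Y).
Hypothesis hq : covering_map q.

(** A sheet [W] over an evenly covered [U], with the remaining sheets remembered
    only through the openness of their union; this is all that is needed to
    confine a connected lift to [W]. *)
Definition sheet (U : set Y) (W : set X) : Prop :=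
  [/\ open W, open (q @^-1` U `\` W) & set_bij W U q].

Lemma exists_sheet (y : Y) : exists2 U, open_nbhs y U &
  forall x, U (q x) -> exists2 W, sheet U W & W x.
Proof.
case: hq => cq oq _ /(_ y)[U Uy [V [tV VW qV]]].
exists U => // x Ux.
have [W VWW Wx] : (\bigcup_(W in V) W) x by rewrite -qV.
exists W => //; have [oW bW] := VW _ VWW; split => //.
suff -> : q @^-1` U `\` W = \bigcup_(W' in V `\ W) W'.
  by apply: bigcup_open => W' [/VW[]].
rewrite qV; apply/seteqP; split => [z [[W' VW' W'z] nWz]|z [W' [VW' WW'] W'z]].
  by exists W' => //; split => // WW'; apply: nWz; rewrite -WW'.
split; first by exists W'.
move=> Wz; apply: WW'; apply: (tV W' W) => //.
by exists z.
Qed.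

Lemma sheet_inj U W x x' : sheet U W -> W x -> W x' -> q x = q x' -> x = x'.
Proof.
by case=> _ _ [_ iW _] Wx Wx' qq; apply: iW; rewrite ?inE.
Qed.

Lemma sheet_section U W x0 : open U -> sheet U W -> W x0 -> exists sec : Y -> X,
  [/\ forall y, U y -> W (sec y) /\ q (sec y) = y,
      forall x, W x -> sec (q x) = x
    & forall y, U y -> {for y, continuous sec}].
Proof.
move=> oU sW Wx0; case: (sW) => oW _ [fW _ sjW].
have /choice[sec secP] : forall y, exists x, U y -> W x /\ q x = y.
  move=> y; have [Uy|nUy] := pselect (U y); last by exists x0.
  by have [x Wx <-] := sjW _ Uy; exists x.
exists sec; split => // [x Wx|y Uy N nN].
  have [] := secP (q x) (fW _ Wx) => Ws qs.
  exact: (sheet_inj sW).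
have [Wy qy] := secP _ Uy.
have [M [oM My] MN] : exists2 M, open_nbhs (sec y) M & M `<=` N.
  by move: nN; rewrite nbhsE => -[M ? ?]; exists M.
have : nbhs y (q @` (W `&` M)).
  apply: open_nbhs_nbhs; split; last by exists (sec y).
  by case: hq => _ oq _ _; apply/oq/openI.
apply: filterS => y' [x [Wx Mx] <-] /=.
have [Ws qs] := secP (q x) (fW _ Wx).
by rewrite (sheet_inj sW Ws Wx qs); exact: MN.
Qed.

(** The two lifts agree on an open set because a sheet is mapped injectively, and
    disagree on an open set because distinct sheets are disjoint. *)
Lemma lift_unique (Z : topologicalType) (l l' : Z -> X) (z0 : Z) :
  connected [set: Z] -> continuous l -> continuous l' ->
  q \o l = q \o l' -> l z0 = l' z0 -> l = l'.
Proof.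
move=> cZ cl cl' ll' l0.
suff E : [set z | l z = l' z] = [set: Z].
  by apply/funext => z; have : [set: Z] z by []; rewrite -E.
apply: cZ; first by exists z0.
- exists [set z | l z = l' z]; rewrite ?setTI// openE => z /= lz.
  have [U [oU Uz] sU] := exists_sheet (q (l z)).
  have [W sW Wz] := sU _ Uz.
  have oW : open W by case: sW.
  have nW : \forall z' \near z, W (l z').
    by apply: cl; exact: open_nbhs_nbhs.
  have nW' : \forall z' \near z, W (l' z').
    by apply: cl'; apply: open_nbhs_nbhs; rewrite -lz.
  near=> z'; apply: (sheet_inj sW); [by near: z'|by near: z'|].
  exact: (congr1 (@^~ z') ll').
- exists [set z | l z = l' z]; rewrite ?setTI// -openC openE => z /= lz.
  have [U [oU Uz] sU] := exists_sheet (q (l z)).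
  have [W sW Wz] := sU _ Uz.
  have qz : q (l z) = q (l' z) by exact: (congr1 (@^~ z) ll').
  have oW : open W by case: sW.
  have nW : \forall z' \near z, W (l z').
    by apply: cl; exact: open_nbhs_nbhs.
  have nW' : \forall z' \near z, (q @^-1` U `\` W) (l' z').
    apply: cl'; apply: open_nbhs_nbhs; split; first by case: sW.
    split; first by rewrite /= -qz.
    by move=> Wl'; apply: lz; exact: (sheet_inj sW).
  near=> z' => /= E.
  have : (q @^-1` U `\` W) (l' z') by near: z'.
  by rewrite -E => -[_]; apply; near: z'.
Unshelve. all: by end_near. Qed.

Lemma connectedR : connected [set: R].
Proof. exact/connected_intervalP. Qed.

Lemma lift_in_sheet (J : set R) (l : R -> X) U W t :
  is_interval J -> continuous l -> sheet U W ->
  (forall s, J s -> U (q (l s))) -> J t -> W (l t) ->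
  forall s, J s -> W (l s).
Proof.
move=> iJ cl [oW oW' _] JU Jt Wt.
have cJ : connected J by apply/connected_intervalP.
suff E : J `&` l @^-1` W = J by move=> s; rewrite -{1}E => -[].
have cl' : forall A, open A -> open (l @^-1` A) by apply/continuousP.
apply: cJ; first by exists t.
- by exists (l @^-1` W); [exact: cl'|].
- exists (~` (l @^-1` (q @^-1` U `\` W))).
    by rewrite closedC; apply: cl'.
  apply/seteqP; split => s [Js]; first by move=> Ws; split => // -[].
  by move=> ns; split => //; apply: contrapT => nW; apply: ns; split => //; exact: JU.
Qed.

Definition clampR (a b t : R) : R := Num.max a (Num.min t b).

Lemma continuous_clampR a b : continuous (clampR a b).
Proof.
move=> t; apply: (@continuous_max R R (cst a) (fun t => Num.min t b)); first exact: cvg_cst.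
apply: (@continuous_min R R id (cst b)); last exact: cvg_cst.
exact: cvg_id.
Qed.

Lemma clampR01 t : 0 <= clampR 0 1 t <= 1.
Proof. by rewrite /clampR le_max lexx/= ge_max ler01 ge_min lexx orbT. Qed.

Lemma clampRE t : clampR 0 1 t = set_val (clamp t).
Proof.
rewrite set_valE /clampR /=.
case: (leP t 1) => t1; case: (leP 0 t) => t0.
- by rewrite min_r.
- by rewrite min_r.
- by rewrite max_r // min_l // ltW.
- by have := lt_trans t0 (lt_trans ltr01 t1); rewrite ltxx.
Qed.

Lemma path_lift (f : R -> Y) (x0 : X) : continuous f -> q x0 = f 0 ->
  (forall t, f t = f (clampR 0 1 t)) ->
  exists l : R -> X, [/\ continuous l, l 0 = x0 & q \o l = f].
Proof.
move=> cf qx0 fcl.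
pose liftable (t : R) := exists l : R -> X,
  [/\ continuous l, l 0 = x0 & forall s : R, 0 <= s <= t -> q (l s) = f s].
suff /(_ 1)[l [cl l0 ql]] : forall t, liftable t.
  exists (l \o clampR 0 1); split.
  - by apply: continuous_compT => //; exact: continuous_clampR.
  - by rewrite /= /clampR min_l ?max_l.
  - apply/funext => t; rewrite /= [RHS]fcl; apply: ql; exact: clampR01.
(* The induction starts at a negative time, where the condition is void. *)
apply: (@real_induction R _ (-1)); last first.
  by exists (fun=> x0); split => // [|s H]; [exact: cst_continuous|exfalso; clear qx0; lra].
move=> t.
have [U [oU Ut] sU] := exists_sheet (f t).
have /nbhs_ballP[e /= e0 eU] : nbhs t (f @^-1` U).
  by apply: cf; exact: open_nbhs_nbhs.
exists (ball t e); first exact: nbhsx_ballx.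
move=> s s' Js Js' [l [cl l0 ql]].
have [s's|ss'] := leP s' s.
  by exists l; split => // r /andP[r0 r1]; apply: ql; rewrite r0 (le_trans r1).
have [s0|s0] := ltP s' 0.
  by exists (fun=> x0); split => // [|r H]; [exact: cst_continuous|exfalso; clear qx0; lra].
(* The given lift is followed up to time [r] and continued inside one sheet; if
   [s] is negative, it tells nothing and the constant lift is used instead. *)
pose r := Num.max 0 s.
have Jr : ball t e r.
  clear qx0; move: Js Js'; rewrite /ball/= !ltr_norml /r => /andP[? ?] /andP[? ?]; apply/andP.
  by case: (leP 0 s) => ?; split; lra.
have [l' [cl' l'0 ql' qr]] : exists l' : R -> X,
    [/\ continuous l', l' 0 = x0, forall s, 0 <= s <= r -> q (l' s) = f s
      & q (l' r) = f r].
  have [s0'|s0'] := leP 0 s.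
    have rs : r = s by rewrite /r max_r.
    by exists l; split; rewrite ?rs // ql // s0' lexx.
  have r0 : r = 0 by rewrite /r max_l // ltW.
  exists (fun=> x0); split => // [|u u0|]; first exact: cst_continuous.
    by rewrite qx0; congr f; apply/le_anti; rewrite -{2}r0.
  by rewrite qx0 r0.
have rs' : r <= s' by rewrite /r ge_max s0 ltW.
have [W sW Wr] : exists2 W, sheet U W & W (l' r).
  by apply: sU; rewrite qr; exact: eU.
have [sec [sec1 sec2 sec3]] := sheet_section oU sW Wr.
have Ju u : ball t e (clampR r s' u).
  clear qx0 qr; move: Jr Js'; rewrite /ball/= !ltr_norml /clampR.
  move=> /andP[? ?] /andP[? ?]; apply/andP.
  by case: (leP u s') => ?; [case: (leP r u) => ?|case: (leP r s') => ?]; split; lra.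
exists (fun u => if u <= r then l' u else sec (f (clampR r s' u))); split.
- (* the gluing lemma compares with 1/2 *)
  have E : forall u, (u <= r) = (1/2 + (u - r) <= 1/2 :> R).
    by by clear qx0 qr; move=> u; apply/idP/idP => ?; lra.
  under eq_fun do rewrite E.
  apply: (@continuous_glue R R X (fun u => 1/2 + (u - r))) => //.
  + move=> u; apply: cvgD; first exact: cvg_cst.
    by apply: cvgB; [exact: cvg_id|exact: cvg_cst].
  + move=> u; apply: continuous_comp; last by apply: sec3; apply: eU.
    by apply: continuous_comp; [exact: continuous_clampR|exact: cf].
  + move=> u h; have -> : u = r by clear qx0 qr; lra.
    rewrite /clampR min_l ?max_l // -qr sec2 //.
- by rewrite /r le_max lexx.
- move=> u /andP[u0 us']; case: (leP u r) => ur; first by rewrite ql' // u0.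
  have cu : clampR r s' u = u by rewrite /clampR min_l // max_r // ltW.
  by have [] := sec1 (f (clampR r s' u)) (eU _ (Ju u)); rewrite cu.
Qed.

(** Continuity at [z0] of a family of lifts propagates from one time to all
    others: near a given time, the lifts with parameter close to [z0] stay in the
    sheet of the lift at [z0], where they are given by a local inverse of [q]. *)
Lemma lift_continuous (Z : topologicalType) (h : Z * R -> Y) (F : Z -> R -> X)
    (z0 : Z) (a : R) :
  continuous h -> (forall z, continuous (F z)) ->
  (forall z t, q (F z t) = h (z, t)) -> {for z0, continuous (F^~ a)} ->
  forall t, {for z0, continuous (F^~ t)}.
Proof.
move=> ch cF qF; apply: real_induction => t.
have [U [oU Ut] sU] := exists_sheet (h (z0, t)).
have : nbhs (z0, t) (h @^-1` U) by apply: ch; exact: open_nbhs_nbhs.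
case=> -[N J'] /= [nN /nbhs_ballP[e /= e0 eJ]] NJU.
have iJ : is_interval (ball t e).
  move=> x y /=; rewrite /ball/= !ltr_norml => /andP[? ?] /andP[? ?] z /andP[? ?].
  by rewrite /ball/= ltr_norml; apply/andP; split; lra.
exists (ball t e); first exact: nbhsx_ballx.
move=> s s' Js Js' cs.
have hU z u : N z -> ball t e u -> U (h (z, u)).
  by move=> Nz Ju; apply: (NJU (z, u)); split => //=; exact: eJ.
have [W sW Ws] : exists2 W, sheet U W & W (F z0 s).
  by apply: sU; rewrite qF; apply: hU => //; exact: nbhs_singleton.
have [sec [sec1 sec2 sec3]] := sheet_section oU sW Ws.
have nW : \forall z \near z0, W (F z s).
  by apply: cs; apply: open_nbhs_nbhs; split => //; case: sW.
have nE : \forall z \near z0, sec (h (z, s')) = F z s'.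
  near=> z; rewrite -qF sec2 //.
  have Nz : N z by near: z.
  apply: (@lift_in_sheet (ball t e) (F z) U W s) => //.
  - by move=> u Ju; rewrite qF; exact: hU.
  - by near: z.
have c2 : {for z0, continuous (fun z => sec (h (z, s')))}.
  apply: (@continuous_comp _ _ _ (fun z => h (z, s')) sec).
    apply: (@continuous_comp _ _ _ (fun z => (z, s')) h); last exact: ch.
    by apply: (@continuous_pair Z Z R id (cst s')) => ?; [exact: cvg_id|exact: cvg_cst].
  by apply: sec3; apply: hU => //; exact: nbhs_singleton.
rewrite /prop_for /continuous_at -(nbhs_singleton nE).
apply: cvg_trans c2; apply: near_eq_cvg.
exact: nE.
Unshelve. all: by end_near. Qed.

End Covering.

(** * Deck transformations of the half-plane *)

Section HalfPlane.
Context {R : realType}.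
Local Notation H2 := (set_type (upper_half_plane R)).

Lemma H2_pos (z : H2) : 0 < (set_val z).2.
Proof. by rewrite set_valE; case: z => t /= /set_mem. Qed.

Lemma segment_subproof (z w : R * R) (t : R) : 0 < z.2 -> 0 < w.2 ->
  (z.1 + clampR 0 1 t * (w.1 - z.1), z.2 + clampR 0 1 t * (w.2 - z.2))
    \in upper_half_plane R.
Proof.
rewrite inE /upper_half_plane /= => z0 w0.
by have /andP[c0 c1] := @clampR01 R t; nra.
Qed.

(** The parametrization is constant outside the unit interval, in order that
    segments be paths defined on the whole line. *)
Definition segment (z w : H2) (t : R) : H2 :=
  exist (fun x => x \in upper_half_plane R) _
    (segment_subproof t (H2_pos z) (H2_pos w)).

Lemma H2_continuousP (T : topologicalType) (f : T -> H2) :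
  continuous (fun x => (set_val (f x)).1) ->
  continuous (fun x => (set_val (f x)).2) -> continuous f.
Proof.
move=> c1 c2; apply/continuous_comp_initial => x.
have -> : set_val \o f = fun x => ((set_val (f x)).1, (set_val (f x)).2).
  by apply/funext => y /=; case: (set_val (f y)).
exact: continuous_pair.
Qed.

Lemma H2_eq (z w : H2) : (set_val z).1 = (set_val w).1 ->
  (set_val z).2 = (set_val w).2 -> z = w.
Proof.
move=> e1 e2; apply: val_inj; rewrite -!set_valE.
by rewrite [set_val z]surjective_pairing [set_val w]surjective_pairing e1 e2.
Qed.

Lemma continuous_H2_fst : continuous (fun z : H2 => (set_val z).1).
Proof.
apply: (@continuous_compT H2 (R * R)%type R set_val fst).
  exact: initial_continuous.
exact: continuous_fst.
Qed.

Lemma continuous_H2_snd : continuous (fun z : H2 => (set_val z).2).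
Proof.
apply: (@continuous_compT H2 (R * R)%type R set_val snd).
  exact: initial_continuous.
exact: continuous_snd.
Qed.

Lemma segment_continuous (z : H2) :
  continuous (fun wt : H2 * R => segment z wt.1 wt.2).
Proof.
have cc : continuous (fun wt : H2 * R => clampR 0 1 wt.2).
  apply: continuous_compT (@continuous_clampR R 0 1).
  exact: continuous_snd.
apply: H2_continuousP => /= x.
  apply: cvgD; first exact: cvg_cst.
  apply: cvgM; first exact: cc.
  apply: cvgB; last exact: cvg_cst.
  exact: (continuous_compT (@continuous_fst H2 R) continuous_H2_fst).
apply: cvgD; first exact: cvg_cst.
apply: cvgM; first exact: cc.
apply: cvgB; last exact: cvg_cst.
exact: (continuous_compT (@continuous_fst H2 R) continuous_H2_snd).
Qed.

Lemma segment_continuousr (z w : H2) : continuous (segment z w).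
Proof.
have cw : continuous (fun t : R => (w, t)).
  apply: (@continuous_pair R H2 R (cst w) id) => t; first exact: cvg_cst.
  exact: cvg_id.
exact: (continuous_compT cw (@segment_continuous z)).
Qed.

Lemma segment0 (z w : H2) : segment z w 0 = z.
Proof.
by apply: H2_eq; rewrite set_valE /= /clampR min_l// max_l// mul0r addr0.
Qed.

Lemma segment1 (z w : H2) : segment z w 1 = w.
Proof.
by apply: H2_eq; rewrite set_valE /= /clampR min_l// max_r// mul1r addrC subrK.
Qed.

Lemma segment_clamp (z w : H2) t : segment z w (clampR 0 1 t) = segment z w t.
Proof.
have e : clampR 0 1 (clampR 0 1 t) = clampR 0 1 t :> R.
  by have /andP[c0 c1] := @clampR01 R t; rewrite {1}/clampR min_l// max_r.
by apply: H2_eq; rewrite set_valE /= e.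
Qed.

Lemma segmentzz (z : H2) t : segment z z t = z.
Proof. by apply: H2_eq; rewrite set_valE /= subrr mulr0 addr0. Qed.

Lemma connected_H2 (z : H2) : connected [set: H2].
Proof.
have -> : [set: H2] = \bigcup_(w in [set: H2]) (segment z w @` [set: R]).
  apply/seteqP; split=> // w _; exists w => //.
  by exists 1 => //; exact: segment1.
apply: bigcup_connected; first by exists z => w _; exists 0 => //; exact: segment0.
move=> w _; apply: connected_continuous_connected; first exact: connectedR.
by apply: continuous_subspaceT; exact: segment_continuousr.
Qed.

Context {S : topologicalType} (q : H2 -> S).
Hypothesis hq : covering_map q.

(** The lifting criterion for a star-shaped domain: the value at [w] is the
    endpoint of the lift of the image of the segment from [z0] to [w]. *)
Lemma self_lift (z0 w0 : H2) : q z0 = q w0 ->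
  exists D : H2 -> H2, [/\ continuous D, q \o D = q & D z0 = w0].
Proof.
move=> q0; have cq : continuous q by case: hq.
have /choice[F FP] : forall w, exists l : R -> H2,
    [/\ continuous l, l 0 = w0 & q \o l = q \o segment z0 w].
  move=> w; apply: (path_lift hq).
  - exact: continuous_compT (@segment_continuousr z0 w) cq.
  - by rewrite /= segment0.
  - by move=> t; rewrite /= segment_clamp.
have cF : continuous (F^~ 1).
  move=> w; apply: (@lift_continuous _ _ _ _ hq _ (q \o (fun wt => segment z0 wt.1 wt.2)) F w 0).
  - exact: continuous_compT (@segment_continuous z0) cq.
  - by move=> w'; case: (FP w').
  - by move=> w' t; case: (FP w') => _ _ /(congr1 (@^~ t)).
  - have -> : F^~ 0 = cst w0 by apply/funext => w'; case: (FP w').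
    exact: cst_continuous.
exists (F^~ 1); split => //.
- by apply/funext => w /=; case: (FP w) => _ _ /(congr1 (@^~ 1)) /= ->; rewrite segment1.
- have [cl l0 ql] := FP z0.
  rewrite (lift_unique (l' := cst w0) (z0 := 0) hq connectedR cl) //.
    exact: cst_continuous.
  by rewrite ql; apply/funext => t /=; rewrite segmentzz.
Qed.

(** The self-lifts that exchange [z0] and [w0] are inverse to each other by
    uniqueness of lifts. *)
Lemma exists_deck_transformation (z0 w0 : H2) : q z0 = q w0 ->
  exists2 D, deck_transformation q D & D z0 = w0.
Proof.
move=> q0; have [D [cD qD D0]] := self_lift q0.
have [E [cE qE E0]] := self_lift (esym q0).
exists D => //; split => //; exists E.
have idc : continuous (@id H2) by move=> x; exact: cvg_id.
split => // z.
- suff ED : E \o D = id by exact: (congr1 (@^~ z) ED).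
  apply: (@lift_unique _ _ _ hq _ (E \o D) id z0) => //=.
  + exact: connected_H2 z0.
  + exact: continuous_compT cD cE.
  + by rewrite compA qE qD.
  + by rewrite D0.
- suff DE : D \o E = id by exact: (congr1 (@^~ z) DE).
  apply: (@lift_unique _ _ _ hq _ (D \o E) id w0) => //=.
  + exact: connected_H2 z0.
  + exact: continuous_compT cE cD.
  + by rewrite compA qD qE.
  + by rewrite E0.
Qed.

Lemma exists_deck_action (p : S) (pt : H2) (a : pi1 R p) : q pt = p ->
  exists D, deck_action q pt a D.
Proof.
move=> qpt; have cq : continuous q by case: hq.
have [l [cl l0 ql]] : exists l : R -> H2,
    [/\ continuous l, l 0 = pt & q \o l = extend (repr a)].
  apply: (path_lift hq); first exact: extend_continuous.
    by rewrite extend_le0.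
  by move=> t; rewrite /extend clampRE set_val_clampK.
have ql1 : q (l 1) = p.
  by have := congr1 (@^~ 1) ql; rewrite /= extend_ge1.
have [D dD Dpt] := exists_deck_transformation (etrans qpt (esym ql1)).
exists D; split => //.
exists (l \o set_val).
  split; first exact: continuous_compT continuous_set_val cl.
  by rewrite /= val_zero val_one l0 Dpt.
exists (repr a); first by rewrite reprK.
apply/funext => t /=; rewrite extend_val -ql //.
Qed.

End HalfPlane.

(** * Hyperbolic trigonometry in the half-plane *)

Section HyperbolicTrigonometry.
Context {R : realType}.
Local Notation H2 := (set_type (upper_half_plane R)).

Definition ch (t : R) : R := (expR t + expR (- t)) / 2.
Definition sh (t : R) : R := (expR t - expR (- t)) / 2.

Lemma chN t : ch (- t) = ch t.
Proof. by rewrite /ch opprK addrC. Qed.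

Lemma ch_norm t : ch `|t| = ch t.
Proof. by case: ger0P => _; rewrite ?chN. Qed.

Lemma expRVN (t : R) : expR t * expR (- t) = 1.
Proof. by rewrite -expRD subrr expR0. Qed.

Lemma ch2_sh2 t : ch t ^+ 2 - sh t ^+ 2 = 1.
Proof. by rewrite -(expRVN t) /ch /sh; field. Qed.

Lemma chB s t : ch (s - t) = ch s * ch t - sh s * sh t.
Proof.
rewrite /ch /sh opprB [t - s]addrC !expRD.
by field.
Qed.

Lemma sh_gt0 t : 0 < t -> 0 < sh t.
Proof.
move=> t0; rewrite /sh divr_gt0// subr_gt0 ltr_expR; lra.
Qed.

Lemma ch_ge1 t : 1 <= ch t.
Proof.
have e0 := expR_gt0 t; have := expRVN t; have := expR_gt0 (- t).
rewrite /ch => b0 ab; have : 0 <= (expR t - expR (- t)) ^+ 2 by exact: sqr_ge0.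
set a := expR t in e0 ab *; set b := expR (- t) in b0 ab * => h.
have h4 : 4 <= (a + b) ^+ 2.
  have -> : (a + b) ^+ 2 = (a - b) ^+ 2 + 4 * (a * b) by ring.
  by rewrite ab; lra.
by nra.
Qed.

Lemma sh_ge_expR n t : 1 <= n -> n <= t -> expR n / 4 <= sh t.
Proof.
move=> n1 nt; rewrite /sh.
have h1 : expR n <= expR t by rewrite ler_expR.
have h2 : expR (- t) <= 1 by rewrite -expR0 ler_expR; lra.
have h3 : 1 + 1 <= expR n by apply: le_trans (expR_ge1Dx n); lra.
lra.
Qed.

Lemma ch_arcosh (u : R) : 1 <= u -> ch (arcosh u) = u.
Proof.
move=> u1; rewrite /ch /arcosh.
set r := Num.sqrt _; have r0 : 0 <= r by exact: sqrtr_ge0.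
have r2 : r ^+ 2 = u ^+ 2 - 1 by rewrite sqr_sqrtr//; nra.
have ur0 : 0 < u + r by lra.
rewrite expRN lnK ?posrE//.
have -> : (u + r)^-1 = u - r.
  apply: (mulfI (lt0r_neq0 ur0)); rewrite divff ?lt0r_neq0//; nra.
by field.
Qed.

Lemma arcosh_ge0 (u : R) : 1 <= u -> 0 <= arcosh u.
Proof.
move=> u1; apply: ln_ge0; have := sqrtr_ge0 (u ^+ 2 - 1); lra.
Qed.

Definition hyp_cosh (z w : H2) : R :=
  1 + (((set_val z).1 - (set_val w).1) ^+ 2 + ((set_val z).2 - (set_val w).2) ^+ 2)
      / (2 * (set_val z).2 * (set_val w).2).

Lemma hyp_distE (z w : H2) : hyp_dist z w = arcosh (hyp_cosh z w).
Proof.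
by rewrite /hyp_dist /hyp_cosh; case: (set_val z) => x y; case: (set_val w).
Qed.

Lemma hyp_cosh_ge1 (z w : H2) : 1 <= hyp_cosh z w.
Proof.
rewrite lerDl; have := H2_pos z; have := H2_pos w => w0 z0.
by rewrite divr_ge0 ?addr_ge0 ?sqr_ge0// ?mulr_ge0// ltW.
Qed.

Lemma hyp_coshE (z w : H2) : hyp_cosh z w = ch (hyp_dist z w).
Proof. by rewrite hyp_distE ch_arcosh// hyp_cosh_ge1. Qed.

Lemma hyp_coshM (z w : H2) :
  hyp_cosh z w * (2 * (set_val z).2 * (set_val w).2) =
  ((set_val z).1 - (set_val w).1) ^+ 2 + (set_val z).2 ^+ 2 + (set_val w).2 ^+ 2.
Proof.
rewrite /hyp_cosh; have := H2_pos z; have := H2_pos w => w0 z0.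
by field; rewrite ?lt0r_neq0.
Qed.

Lemma hyp_cosh_le (z w : H2) M : hyp_dist z w <= M -> hyp_cosh z w <= expR M.
Proof.
move=> dM; rewrite hyp_coshE /ch.
have d0 : 0 <= hyp_dist z w by rewrite hyp_distE arcosh_ge0// hyp_cosh_ge1.
have h1 : expR (hyp_dist z w) <= expR M by rewrite ler_expR.
have h2 : expR (- hyp_dist z w) <= expR M by rewrite ler_expR; lra.
lra.
Qed.

(** For [(c, s)] on the unit circle, [w] lies at distance [t] from [z] on the
    geodesic that leaves [z] in the direction of cosine [c] and sine [s]; the usual formula has been cleared of
    its denominator [ch t - s * sh t]. *)
Definition polar_at (z w : H2) (t c s : R) : Prop :=
  (set_val w).1 - (set_val z).1 = (set_val w).2 * sh t * c /\
  (set_val z).2 = (set_val w).2 * (ch t - s * sh t).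

Lemma exists_polar (z w : H2) t : 0 < t -> exists c s, polar_at z w t c s.
Proof.
move=> t0; have w0 := H2_pos w; have s0 := sh_gt0 t0.
exists (((set_val w).1 - (set_val z).1) / ((set_val w).2 * sh t)).
exists ((ch t - (set_val z).2 / (set_val w).2) / sh t).
by split; field; rewrite ?lt0r_neq0.
Qed.

Lemma polar_unit (z w : H2) t c s : 0 < t -> hyp_dist z w = t ->
  polar_at z w t c s -> c ^+ 2 + s ^+ 2 = 1.
Proof.
move=> t0 dt [ec es]; have := hyp_coshM z w; rewrite hyp_coshE dt.
have w0 := H2_pos w; have s0 := sh_gt0 t0; have cs := ch2_sh2 t.
have -> : (set_val z).1 - (set_val w).1 = - ((set_val w).2 * sh t * c).
  by rewrite -ec; ring.
rewrite es; set Y := (set_val w).2 in w0 *.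
move=> E.
have : Y ^+ 2 * sh t ^+ 2 * (c ^+ 2 + s ^+ 2 - 1) = 0.
  have -> : Y ^+ 2 * sh t ^+ 2 * (c ^+ 2 + s ^+ 2 - 1) =
     (- (Y * sh t * c)) ^+ 2 + (Y * (ch t - s * sh t)) ^+ 2 + Y ^+ 2 -
     ch t * (2 * (Y * (ch t - s * sh t)) * Y)
     + Y ^+ 2 * (ch t ^+ 2 - sh t ^+ 2 - 1) by ring.
  by rewrite -E cs subrr subrr mulr0 addr0.
have nz : Y ^+ 2 * sh t ^+ 2 != 0 by rewrite mulf_neq0 ?expf_neq0 ?lt0r_neq0.
by move=> /eqP; rewrite mulf_eq0 (negPf nz) /= => /eqP; lra.
Qed.

(** Expanding about [z], the numerator of [hyp_cosh w w'] is the sum of those of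
    [hyp_cosh z w] and [hyp_cosh z w'] up to terms that [polar_at] expresses
    through the angles. *)
Lemma law_of_cosines (z w w' : H2) t t' c c' s s' :
  hyp_dist z w = t -> hyp_dist z w' = t' ->
  polar_at z w t c s -> polar_at z w' t' c' s' ->
  hyp_cosh w w' = ch t * ch t' - sh t * sh t' * (c * c' + s * s').
Proof.
move=> dt dt' [ec es] [ec' es'].
have := hyp_coshM z w; have := hyp_coshM z w'; rewrite !hyp_coshE dt dt'.
have := hyp_coshM w w'; rewrite -hyp_coshE.
have w0 := H2_pos w; have w0' := H2_pos w'.
move: ec es ec' es'.
set x := (set_val z).1; set y := (set_val z).2.
set X := (set_val w).1; set Y := (set_val w).2 in w0 *.
set X' := (set_val w').1; set Y' := (set_val w').2 in w0' *.
move=> ec es ec' es' E2 E1' E1.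
have nz : 2 * Y * Y' != 0 by rewrite !mulf_neq0 ?lt0r_neq0.
apply: (mulIf nz); rewrite E2.
have -> : (X - X') ^+ 2 + Y ^+ 2 + Y' ^+ 2 =
  ((x - X) ^+ 2 + y ^+ 2 + Y ^+ 2) + ((x - X') ^+ 2 + y ^+ 2 + Y' ^+ 2)
  - 2 * y * y - 2 * (X - x) * (X' - x) by ring.
rewrite -E1 -E1' ec ec'.
have -> : ch t * (2 * y * Y) + ch t' * (2 * y * Y') - 2 * y * y =
   2 * Y * Y' * (ch t * ch t') - 2 * (Y * ch t - y) * (Y' * ch t' - y) by ring.
have -> : Y * ch t - y = Y * s * sh t by rewrite es; ring.
have -> : Y' * ch t' - y = Y' * s' * sh t' by rewrite es'; ring.
by ring.
Qed.

Lemma is_derive_right_slope (f : R -> R) (df : R) :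
  is_derive (0 : R) (1 : R) f df -> (fun t => (f t - f 0) / t) @ 0^'+ --> df.
Proof.
move=> [fd <-].
apply: cvg_trans (cvg_dnbhs_at_right fd).
apply: near_eq_cvg; near=> t.
by rewrite /= addr0 /GRing.scale /= mulr1 mulrC.
Unshelve. all: by end_near. Qed.

Lemma cvg_expR_slope : (fun t : R => (expR t - 1) / t) @ 0^'+ --> (1 : R).
Proof. by have := is_derive_right_slope (is_derive_expR (0 : R)); rewrite expR0. Qed.

Lemma cvg_expR0 : (fun t : R => expR t) @ 0^'+ --> (1 : R).
Proof. by rewrite -expR0; apply: cvg_at_right_filter; exact: continuous_expR. Qed.

Lemma cvg_expRN0 : (fun t : R => expR (- t)) @ 0^'+ --> (1 : R).
Proof.
have : (fun t : R => (expR t)^-1) @ 0^'+ --> (1^-1 : R).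
  by apply: cvgV; [exact: oner_neq0|exact: cvg_expR0].
rewrite invr1; apply: cvg_trans; apply: near_eq_cvg; near=> t.
by rewrite expRN.
Unshelve. all: by end_near. Qed.

Lemma cvg_ch0 : (fun t : R => ch t) @ 0^'+ --> (1 : R).
Proof.
have : (fun t : R => ch t) @ 0^'+ --> ((1 + 1) / 2 : R).
  by apply: cvgM; [apply: cvgD; [exact: cvg_expR0|exact: cvg_expRN0]|exact: cvg_cst].
by have -> : (1 + 1) / 2 = 1 :> R by field.
Qed.

Lemma cvg_sh0 : (fun t : R => sh t) @ 0^'+ --> (0 : R).
Proof.
have : (fun t : R => sh t) @ 0^'+ --> ((1 - 1) / 2 : R).
  by apply: cvgM; [apply: cvgB; [exact: cvg_expR0|exact: cvg_expRN0]|exact: cvg_cst].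
by rewrite subrr mul0r.
Qed.

Lemma cvg_sh_slope : (fun t : R => sh t / t) @ 0^'+ --> (1 : R).
Proof.
have : (fun t : R => (expR t - 1) / t * ((1 + expR (- t)) / 2)) @ 0^'+
    --> (1 * ((1 + 1) / 2) : R).
  apply: cvgM; first exact: cvg_expR_slope.
  apply: cvgM; last exact: cvg_cst.
  by apply: cvgD; [exact: cvg_cst|exact: cvg_expRN0].
have -> : 1 * ((1 + 1) / 2) = 1 :> R by field.
apply: cvg_trans; apply: near_eq_cvg; near=> t.
have t0 : t != 0 by rewrite gt_eqF.
by have := expRVN t; rewrite /sh => e; field: e.
Unshelve. all: by end_near. Qed.

Lemma cvg_ch_slope : (fun t : R => (ch t - 1) / t) @ 0^'+ --> (0 : R).
Proof.
have : (fun t : R => (expR t - 1) / t * ((1 - expR (- t)) / 2)) @ 0^'+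
    --> (1 * ((1 - 1) / 2) : R).
  apply: cvgM; first exact: cvg_expR_slope.
  apply: cvgM; last exact: cvg_cst.
  by apply: cvgB; [exact: cvg_cst|exact: cvg_expRN0].
rewrite subrr mul0r mulr0.
apply: cvg_trans; apply: near_eq_cvg; near=> t.
have t0 : t != 0 by rewrite gt_eqF.
by have := expRVN t; rewrite /ch => e; field: e.
Unshelve. all: by end_near. Qed.

(** By the equality case of the law of cosines, all points of an isometrically
    embedded ray have the same polar angle; the initial derivative identifies
    this angle with [theta]. *)
Lemma geodesic_ray_polar (x0 : H2) theta gamma : geodesic_ray x0 theta gamma ->
  forall t, 0 < t -> polar_at x0 (gamma t) t (cos theta) (sin theta).
Proof.
move=> [g0 gd gl1 gl2].
have d0 t : 0 < t -> hyp_dist x0 (gamma t) = t.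
  by move=> t0; rewrite -g0 gd ?(ltW t0)// sub0r normrN gtr0_norm.
have [c [s p1]] := exists_polar x0 (gamma 1) ltr01.
have pol t : 0 < t -> polar_at x0 (gamma t) t c s.
  move=> t0; have [c' [s' p2]] := exists_polar x0 (gamma t) t0.
  have u1 := polar_unit ltr01 (d0 _ ltr01) p1.
  have u2 := polar_unit t0 (d0 _ t0) p2.
  have := law_of_cosines (d0 _ ltr01) (d0 _ t0) p1 p2.
  rewrite hyp_coshE gd ?(ltW t0)// ch_norm chB => E.
  have s1 : 0 < sh 1 by exact/sh_gt0/ltr01.
  have st := sh_gt0 t0.
  have /eqP : sh 1 * sh t * (1 - (c * c' + s * s')) = 0 by rewrite mulrBr mulr1; lra.
  rewrite mulf_eq0 (negPf (mulf_neq0 (lt0r_neq0 s1) (lt0r_neq0 st))) /= => /eqP cs.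
  have : (c - c') ^+ 2 + (s - s') ^+ 2 = 0 by nra.
  move=> /eqP; rewrite paddr_eq0 ?sqr_ge0// !sqrf_eq0 !subr_eq0.
  by move=> /andP[/eqP -> /eqP ->].
set x := (set_val x0).1; set y := (set_val x0).2.
have y0 : 0 < y by exact: H2_pos.
have cY : (fun t => (set_val (gamma t)).2) @ 0^'+ --> y.
  have cD : (fun t => ch t - s * sh t) @ 0^'+ --> (1 : R).
    have : (fun t => ch t - s * sh t) @ 0^'+ --> 1 - s * 0.
      by apply: cvgB; [exact: cvg_ch0|apply: cvgM; [exact: cvg_cst|exact: cvg_sh0]].
    by rewrite mulr0 subr0.
  have : (fun t => y * (ch t - s * sh t)^-1) @ 0^'+ --> y * 1^-1.
    by apply: cvgM; [exact: cvg_cst|apply: cvgV => //; exact: oner_neq0].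
  rewrite invr1 mulr1; apply: cvg_trans; apply: near_eq_cvg; near=> t.
  have t0 : 0 < t by [].
  have [_] := pol _ t0; rewrite -/y => ->.
  have gp := H2_pos (gamma t).
  have [_ e] := pol _ t0; have nz : ch t - s * sh t != 0.
    by apply/eqP => e0; move: y0; rewrite /y e e0 mulr0 ltxx.
  by rewrite mulfK.
have -> : cos theta = c.
  have l2 : (fun t => ((set_val (gamma t)).1 - x) / t) @ 0^'+ --> y * c.
    have : (fun t => (set_val (gamma t)).2 * (sh t / t * c)) @ 0^'+ --> y * (1 * c).
      by apply: cvgM => //; apply: cvgM; [exact: cvg_sh_slope|exact: cvg_cst].
    rewrite mul1r; apply: cvg_trans; apply: near_eq_cvg; near=> t.
    have t0 : 0 < t by [].
    by have [-> _] := pol _ t0; rewrite !mulrA mulrAC.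
  apply: (mulfI (lt0r_neq0 y0)); exact: (cvg_unique _ gl1 l2).
have -> : sin theta = s.
  have l2 : (fun t => ((set_val (gamma t)).2 - y) / t) @ 0^'+ --> y * s.
    have : (fun t => (set_val (gamma t)).2 * (s * (sh t / t) - (ch t - 1) / t)) @ 0^'+ --> y * (s * 1 - 0).
      apply: cvgM => //; apply: cvgB; last exact: cvg_ch_slope.
      by apply: cvgM; [exact: cvg_cst|exact: cvg_sh_slope].
    rewrite mulr1 subr0; apply: cvg_trans; apply: near_eq_cvg; near=> t.
    have t0 : 0 < t by [].
    have [_] := pol _ t0; rewrite -/y => ->.
    by field; rewrite gt_eqF.
  apply: (mulfI (lt0r_neq0 y0)); exact: (cvg_unique _ gl2 l2).
exact: pol.
Unshelve. all: by end_near. Qed.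

End HyperbolicTrigonometry.

(** * Isometries with bounded displacement *)

Section BoundedDisplacement.
Context {R : realType}.
Local Notation H2 := (set_type (upper_half_plane R)).

Lemma small_eq0 (x C : R) : 0 <= C ->
  (forall r, 0 < r -> r <= 1 -> `|x| <= C * r) -> x = 0.
Proof.
move=> C0 h; apply/eqP; rewrite -normr_le0 leNgt; apply/negP => x0.
set r := `|x| / (`|x| + C + 1).
have d0 : 0 < `|x| + C + 1 by lra.
have rE : r * (`|x| + C + 1) = `|x| by rewrite /r divfK ?lt0r_neq0.
have r0 : 0 < r by rewrite divr_gt0.
have r1 : r <= 1 by rewrite /r ler_pdivrMr// mul1r; lra.
have := h r r0 r1; nra.
Qed.

(** A geodesic at bounded distance from the vertical line at [x], both being
    parametrized by the height [s] on the line.  The point at parameter [s] is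
    [(x + s * b s, s * a s)] and the equation says that distances are those of
    the line.  Put [P t] for [b t ^+ 2 + a t ^+ 2].  As [s / t] tends to 0, the
    equation becomes [P t = a s * a t].  Small [s] with two values of [t] show that
    [P t / a t] does not depend on [t]; then a fixed [s] and large [t] show that
    this ratio is [a s]. *)
Lemma bounded_vertical_geodesic (a b : R -> R) (k K : R) : 0 < k ->
  (forall s, 0 < s -> k <= a s <= K) -> (forall s, 0 < s -> `|b s| <= K) ->
  (forall s t, 0 < s -> 0 < t ->
    (s * b s - t * b t) ^+ 2 + s ^+ 2 * a s ^+ 2 + t ^+ 2 * a t ^+ 2 =
    a s * a t * (s ^+ 2 + t ^+ 2)) ->
  forall s t, 0 < s -> 0 < t -> b s = 0 /\ a s = a t.
Proof.
move=> k0 ha hb E.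
pose P s := b s ^+ 2 + a s ^+ 2.
have K0 : 0 < K by have /andP[h1 h2] := ha 1 ltr01; apply: lt_le_trans h2; apply: lt_le_trans h1.
(* [r] is the ratio of the two heights *)
have est t r : 0 < t -> 0 < r -> r <= 1 ->
    `|P t - a (r * t) * a t| <= 5 * K ^+ 2 * r.
  move=> t0 r0 r1; have rt0 : 0 < r * t by rewrite mulr_gt0.
  have /andP[a1 a2] := ha _ t0; have /andP[a1' a2'] := ha _ rt0.
  have := E (r * t) t rt0 t0; have := hb _ t0; have := hb _ rt0.
  rewrite !ler_norml /P; move: a1 a2 a1' a2'.
  set A := a t; set B := b t; set A' := a (r * t); set B' := b (r * t).
  move=> a1 a2 a1' a2' /andP[b1' b2'] /andP[b1 b2] e.
  have e1 : B ^+ 2 + A ^+ 2 - A' * A =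
      r * (r * (A' * A) - r * A' ^+ 2 - r * B' ^+ 2 + 2 * B' * B).
    have t2 : t ^+ 2 != 0 by rewrite expf_neq0 ?lt0r_neq0.
    apply: (mulfI t2).
    have := e; have -> : (r * t * B' - t * B) ^+ 2 + (r * t) ^+ 2 * A' ^+ 2 +
      t ^+ 2 * A ^+ 2 = t ^+ 2 * ((r * B' - B) ^+ 2 + r ^+ 2 * A' ^+ 2 + A ^+ 2) by ring.
    have -> : A' * A * ((r * t) ^+ 2 + t ^+ 2) = t ^+ 2 * (A' * A * (r ^+ 2 + 1)) by ring.
    by move=> /(mulfI t2) e'; congr (_ * _); lra.
  rewrite e1.
  have q1 : 0 <= A' * A <= K ^+ 2 by apply/andP; split; nra.
  have q2 : 0 <= A' ^+ 2 <= K ^+ 2 by apply/andP; split; nra.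
  have q3 : 0 <= B' ^+ 2 <= K ^+ 2 by apply/andP; split; nra.
  have q4 : - K ^+ 2 <= B' * B <= K ^+ 2 by apply/andP; split; nra.
  move: q1 q2 q3 q4; set x1 := A' * A; set x2 := A' ^+ 2; set x3 := B' ^+ 2; set K2 := K ^+ 2.
  rewrite -[2 * B' * B]mulrA; set x4 := B' * B.
  move=> /andP[? ?] /andP[? ?] /andP[? ?] /andP[? ?].
  have s1 : 0 <= r * x1 <= K2 by apply/andP; split; nra.
  have s2 : 0 <= r * x2 <= K2 by apply/andP; split; nra.
  have s3 : 0 <= r * x3 <= K2 by apply/andP; split; nra.
  move: s1 s2 s3 => /andP[? ?] /andP[? ?] /andP[? ?].
  by apply/andP; split; nra.
have PP s t : 0 < s -> 0 < t -> P s * a t = P t * a s.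
  wlog st : s t / s <= t.
    move=> w s0 t0; have [st|ts] := leP s t; first exact: w.
    by apply/esym/w => //; exact: ltW.
  move=> s0 t0; apply/eqP; rewrite -subr_eq0; apply/eqP.
  apply: (@small_eq0 _ (10 * K ^+ 3)); first by rewrite mulr_ge0 ?exprn_ge0 ?ltW//.
  move=> r r0 r1.
  (* compare both with the height [r * s] *)
  have rst : r * s / t <= 1 by rewrite ler_pdivrMr// mul1r; nra.
  have rst0 : 0 < r * s / t by rewrite divr_gt0 ?mulr_gt0.
  have rstr : r * s / t <= r by rewrite ler_pdivrMr//; nra.
  have := est s r s0 r0 r1; have := est t (r * s / t) t0 rst0 rst.
  rewrite divfK ?lt0r_neq0//.
  have /andP[a1 a2] := ha _ s0; have /andP[a1' a2'] := ha _ t0.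
  rewrite !ler_norml => /andP[h1 h2] /andP[h3 h4].
  have -> : P s * a t - P t * a s =
     (P s - a (r * s) * a s) * a t - (P t - a (r * s) * a t) * a s by ring.
  set u := (P s - _) in h3 h4 *; set v := (P t - _) in h1 h2 *.
  have K2 : 0 <= K ^+ 2 by exact: sqr_ge0.
  have h5 : 5 * K ^+ 2 * (r * s / t) <= 5 * K ^+ 2 * r by apply: ler_wpM2l => //; rewrite mulr_ge0.
  have -> : 10 * K ^+ 3 * r = (5 * K ^+ 2 * r) * K + (5 * K ^+ 2 * r) * K by ring.
  have w0 : 0 <= 5 * K ^+ 2 * r by rewrite !mulr_ge0 ?ltW//.
  move: h1 h2 h3 h4 h5 w0; set w := 5 * K ^+ 2 * r; set w' := 5 * K ^+ 2 * _.
  move=> *; apply/andP; split; nra.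
have Pa t : 0 < t -> P t = a t ^+ 2.
  move=> t0; apply/eqP; rewrite -subr_eq0; apply/eqP.
  apply: (@small_eq0 _ (5 * K ^+ 3 / k)).
    by rewrite divr_ge0 ?mulr_ge0 ?exprn_ge0 ?ltW//.
  move=> r r0 r1.
  have s0 : 0 < t / r by rewrite divr_gt0.
  have := est (t / r) r s0 r0 r1; rewrite mulrCA divff ?lt0r_neq0// mulr1.
  have /andP[a1 a2] := ha _ s0; have /andP[a1' a2'] := ha _ t0.
  have as0 : 0 < a (t / r) by lra.
  have at0 : 0 < a t by lra.
  move=> h.
  have e : (P t - a t ^+ 2) * a (t / r) = (P (t / r) - a t * a (t / r)) * a t.
    by rewrite !mulrBl -(PP (t / r) t) //; ring.
  have h2 : `|P t - a t ^+ 2| * a (t / r) <= 5 * K ^+ 2 * r * K.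
    rewrite -[X in _ * X]gtr0_norm// -normrM e normrM (gtr0_norm at0).
    by apply: ler_pM => //; rewrite ltW.
  rewrite mulrAC ler_pdivlMr//.
  apply: le_trans (_ : `|P t - a t ^+ 2| * a (t / r) <= _).
    by rewrite ler_wpM2l.
  by apply: le_trans h2 _; rewrite le_eqVlt; apply/orP; left; apply/eqP; ring.
move=> s t s0 t0; have := PP _ _ s0 t0; rewrite (Pa _ s0) (Pa _ t0) => e.
have /andP[a1 a2] := ha _ s0; have /andP[a1' a2'] := ha _ t0.
split.
  have : b s ^+ 2 = 0 by have := Pa _ s0; rewrite /P; lra.
  by move=> /eqP; rewrite sqrf_eq0 => /eqP.
have nz : a s * a t != 0 by rewrite mulf_neq0 ?gt_eqF//; lra.
by apply: (mulfI nz); rewrite mulrAC -expr2 e; ring.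
Qed.

Lemma mkH2_subproof (x y : R) : 0 < y -> (x, y) \in upper_half_plane R.
Proof. by move=> y0; rewrite inE. Qed.

Definition mkH2 (x y : R) (y0 : 0 < y) : H2 :=
  exist (fun z => z \in upper_half_plane R) _ (mkH2_subproof x y0).

(** Each vertical line is mapped to a geodesic that stays close to it, hence to
    itself; so [D] is [(x, y) |-> (x, al x * y)].  Distances between points of two
    vertical lines force [al] to be constant, and then equal to 1. *)
Lemma bounded_displacement_id (D : H2 -> H2) (M : R) :
  (forall z w, hyp_dist (D z) (D w) = hyp_dist z w) ->
  (forall z, hyp_dist (D z) z <= M) -> forall z, D z = z.
Proof.
move=> isoD dispD.
have isoC z w : hyp_cosh (D z) (D w) = hyp_cosh z w by rewrite !hyp_coshE isoD.
pose B := expR M; have B1 : 0 < B by exact: expR_gt0.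
pose pt x y : H2 := insubd (mkH2 0 ltr01) (x, y).
have ptE x y : 0 < y -> set_val (pt x y) = (x, y).
  by move=> y0; rewrite set_valE insubdK// inE.
pose u x y := (set_val (D (pt x y))).1; pose v x y := (set_val (D (pt x y))).2.
have v0 x y : 0 < v x y by exact: H2_pos.
have bnd x y : 0 < y -> (u x y - x) ^+ 2 + v x y ^+ 2 + y ^+ 2 <= 2 * B * v x y * y.
  move=> y0; have := hyp_coshM (D (pt x y)) (pt x y); rewrite ptE//= -/(u x y) -/(v x y) => <-.
  have := hyp_cosh_le (dispD (pt x y)); rewrite -/B => h.
  have p0 : 0 < v x y * y by rewrite mulr_gt0.
  by nra.
have eqn x y x' y' : 0 < y -> 0 < y' ->
    ((u x y - u x' y') ^+ 2 + v x y ^+ 2 + v x' y' ^+ 2) * (y * y') =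
    ((x - x') ^+ 2 + y ^+ 2 + y' ^+ 2) * (v x y * v x' y').
  move=> y0 y0'.
  have := hyp_coshM (D (pt x y)) (D (pt x' y')).
  have := hyp_coshM (pt x y) (pt x' y').
  rewrite isoC !ptE//= -/(u x y) -/(v x y) -/(u x' y') -/(v x' y') => <- <-.
  by ring.
have vert x y y' : 0 < y -> 0 < y' -> u x y = x /\ v x y / y = v x y' / y'.
  move=> y0 y0'.
  pose b s := (u x s - x) / s; pose a s := v x s / s.
  have ua s : 0 < s -> u x s = x + s * b s by move=> s0; rewrite /b; field; rewrite gt_eqF.
  have va s : 0 < s -> v x s = s * a s by move=> s0; rewrite /a; field; rewrite gt_eqF.
  have a0 s : 0 < s -> 0 < a s by move=> s0; rewrite /a divr_gt0.
  have bnd' s : 0 < s -> b s ^+ 2 + a s ^+ 2 + 1 <= 2 * B * a s.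
    move=> s0; have := bnd x s s0; rewrite ua// va// => h.
    have s2 : 0 < s ^+ 2 by rewrite exprn_gt0.
    rewrite -(ler_pM2l s2); move: h.
    have -> : (x + s * b s - x) ^+ 2 + (s * a s) ^+ 2 + s ^+ 2 =
              s ^+ 2 * (b s ^+ 2 + a s ^+ 2 + 1) by ring.
    by have -> : 2 * B * (s * a s) * s = s ^+ 2 * (2 * B * a s) by ring.
  have aK s : 0 < s -> (2 * B)^-1 <= a s <= 2 * B.
    move=> s0; have h := bnd' s s0; have h1 := a0 s s0.
    have hb : 0 <= b s ^+ 2 by exact: sqr_ge0.
    apply/andP; split; last by nra.
    rewrite -[X in X <= _]mul1r ler_pdivrMr ?mulr_gt0//.
    have : 0 <= b s ^+ 2 + a s ^+ 2 by rewrite addr_ge0 ?sqr_ge0.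
    by nra.
  have bK s : 0 < s -> `|b s| <= 2 * B.
    move=> s0; have h := bnd' s s0; have h1 := a0 s s0.
    have /andP[h2 h3] := aK s s0.
    have h4 : b s ^+ 2 <= (2 * B) ^+ 2 by nra.
    by rewrite ler_norml; apply/andP; split; nra.
  have [||b0 ae] := @bounded_vertical_geodesic a b (2 * B)^-1 (2 * B) _ aK bK _ y y' y0 y0'.
  - by rewrite invr_gt0 mulr_gt0.
  - move=> s t s0 t0; have := eqn x s x t s0 t0; rewrite !ua// !va//.
    have st : s * t != 0 by rewrite mulf_neq0 ?gt_eqF.
    move=> e; apply: (mulIf st).
    have -> : s * b s - t * b t = x + s * b s - (x + t * b t) by ring.
    by rewrite -!exprMn e; ring.
  - by split => //; rewrite ua// b0 mulr0 addr0.
pose al x := v x 1.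
have uE x y : 0 < y -> u x y = x by move=> y0; have [] := vert x y 1 y0 ltr01.
have vE x y : 0 < y -> v x y = al x * y.
  move=> y0; have [_] := vert x y 1 y0 ltr01.
  by rewrite divr1 -/(al x) => <-; rewrite divfK ?gt_eqF.
have al1 x : al x = 1.
  have al0 : 0 < al x by exact: v0.
  have al0' : 0 < al (x + 1) by exact: v0.
  (* the heights 1 and 2 suffice: the difference of the two equations is
     [3 * (p - p') ^+ 2 = 0] *)
  have e1 := eqn x 1 (x + 1) 1 ltr01 ltr01; have e2 := eqn x 2 (x + 1) 2 (ltr0Sn _ _) (ltr0Sn _ _).
  move: e1 e2; rewrite !uE// !vE//.
  set p := al x in al0 *; set p' := al _ in al0' * => e1 e2.
  have e3 : (p - p') ^+ 2 = 0 by nra.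
  have e4 : p = p' by move: e3 => /eqP; rewrite sqrf_eq0 subr_eq0 => /eqP.
  have : (p - 1) * (p + 1) = 0 by rewrite -e4 in e1 e2; nra.
  by move=> /eqP; rewrite mulf_eq0 subr_eq0 => /orP[/eqP//|/eqP]; lra.
move=> z; have zE : pt (set_val z).1 (set_val z).2 = z.
  by apply: val_inj; rewrite -!set_valE ptE ?H2_pos// -surjective_pairing.
have z0 := H2_pos z.
apply: H2_eq; rewrite -{1}zE.
  by rewrite -/(u _ _) uE.
by rewrite -/(v _ _) vE// al1 mul1r.
Qed.

End BoundedDisplacement.

(** * Directions of rays that come close to each other *)

Section Angles.
Context {R : realType}.
Local Notation H2 := (set_type (upper_half_plane R)).

(** From [sin (2 * w) = 2 * sin w * cos w], the mean value theorem for [sin w],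
    and [cos >= cos (pi / 4)] on the interval concerned. *)
Lemma sin_ge_half (v : R) : 0 <= v <= pi / 2 -> v / 2 <= sin v.
Proof.
move=> /andP[v0 vp].
have [->|vn0] := eqVneq v 0; first by rewrite mul0r sin0.
have {v0}v0 : 0 < v by rewrite lt_neqAle eq_sym vn0.
have p0 := @pi_gt0 R.
pose w := v / 2; have w0 : 0 < w by rewrite /w; lra.
have wp : w <= pi / 4 by rewrite /w; lra.
have vw : v = w *+ 2 by rewrite mulr2n /w; lra.
have c4 : cos (pi / 4) ^+ 2 = 1 / 2 :> R.
  have := cos_mulr2n (pi / 4 : R).
  have -> : (pi / 4) *+ 2 = pi / 2 :> R by rewrite mulr2n; lra.
  by rewrite cos_pihalf; lra.
have c40 : 0 <= cos (pi / 4) :> R by apply: cos_ge0_pihalf; apply/andP; split; lra.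
have mono (x : R) : 0 <= x -> x <= pi / 4 -> cos (pi / 4) <= cos x.
  by move=> x0 xp; rewrite leNgt ltr_cos ?in_itv/=; [rewrite -leNgt|apply/andP; split; lra..].
have [x xw] : exists2 x : R, x \in `]0, w[ & sin w - sin 0 = cos x * (w - 0) :> R.
  apply: MVT => //.
  by apply: continuous_subspaceT => x; exact: continuous_sin.
rewrite sin0 !subr0 => sw.
have cx : cos (pi / 4) <= cos x by apply: mono; move: xw; rewrite in_itv/= => /andP[? ?]; lra.
have cw : cos (pi / 4) <= cos w by apply: mono; lra.
rewrite vw sin_mulr2n sw.
have : 1 / 2 <= cos x * cos w by rewrite -c4 expr2; apply: ler_pM.
rewrite mulr2n; nra.
Qed.

Lemma one_sub_cos_ge (d : R) : 0 <= d <= pi -> d ^+ 2 / 8 <= 1 - cos d.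
Proof.
move=> /andP[d0 dp].
have h := @sin_ge_half (d / 2) ltac:(apply/andP; split; lra).
have -> : cos d = cos (d / 2 *+ 2) by congr cos; rewrite mulr2n; lra.
rewrite cos_mulr2n; have := cos2Dsin2 (d / 2) => e.
have : (d / 2 / 2) ^+ 2 <= sin (d / 2) ^+ 2 by nra.
nra.
Qed.

Lemma cos_norm (d : R) : cos `|d| = cos d.
Proof. by case: ger0P => _; rewrite ?cosN. Qed.

Lemma angle_close (d e : R) : 0 <= e -> `|d| <= 2 * pi -> 1 - cos d <= e ^+ 2 ->
  [\/ `|d| <= 3 * e, `|d - 2 * pi| <= 3 * e | `|d + 2 * pi| <= 3 * e].
Proof.
move=> e0 dp h.
have [d1|d1] := leP `|d| pi.
  apply: Or31; have := @one_sub_cos_ge `|d| ltac:(rewrite normr_ge0 d1 //).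
  by rewrite cos_norm; have := normr_ge0 d; nra.
have := @one_sub_cos_ge (2 * pi - `|d|) ltac:(apply/andP; split; lra).
have -> : cos (2 * pi - `|d|) = cos d.
  by rewrite -cosN opprB mulr_natl -cosD2pi subrK cos_norm.
move=> h2; have h3 : 2 * pi - `|d| <= 3 * e by nra.
have [d0|d0] := leP 0 d.
  apply: Or32; move: dp h3; rewrite ger0_norm// => dp h3.
  by rewrite ler_norml; apply/andP; split; lra.
apply: Or33; move: dp h3; rewrite ltr0_norm// => dp h3.
by rewrite ler_norml; apply/andP; split; lra.
Qed.

Lemma ray_cosines (x0 : H2) th1 th2 g1 g2 t1 t2 :
  geodesic_ray x0 th1 g1 -> geodesic_ray x0 th2 g2 -> 0 < t1 -> 0 < t2 ->
  hyp_cosh (g1 t1) (g2 t2) = ch t1 * ch t2 - sh t1 * sh t2 * cos (th1 - th2).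
Proof.
move=> r1 r2 t10 t20; rewrite cosB.
have d0 th g t : geodesic_ray x0 th g -> 0 < t -> hyp_dist x0 (g t) = t.
  by move=> [<- gd _ _] t0; rewrite gd ?(ltW t0)// sub0r normrN gtr0_norm.
apply: law_of_cosines (d0 _ _ _ r1 t10) (d0 _ _ _ r2 t20) _ _; exact: geodesic_ray_polar.
Qed.

(** The law of cosines reads
    [cosh d = cosh (t1 - t2) + sinh t1 * sinh t2 * (1 - cos (th1 - th2))],
    and [sinh t >= expR n / 4] from time [n] on. *)
Lemma ray_angle_close (x0 : H2) th1 th2 g1 g2 t1 t2 n M :
  geodesic_ray x0 th1 g1 -> geodesic_ray x0 th2 g2 ->
  1 <= n -> n <= t1 -> n <= t2 -> hyp_dist (g1 t1) (g2 t2) <= M ->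
  1 - cos (th1 - th2) <= (4 * expR (M / 2) * expR (- n)) ^+ 2.
Proof.
move=> r1 r2 n1 nt1 nt2 /hyp_cosh_le.
rewrite (ray_cosines r1 r2); [|lra..].
have := ch_ge1 (t1 - t2); rewrite chB.
have := sh_ge_expR n1 nt1; have := sh_ge_expR n1 nt2.
set s1 := sh t1; set s2 := sh t2; set c := cos _ => h2 h1 hc h.
have -> : (4 * expR (M / 2) * expR (- n)) ^+ 2 = 16 * expR M * expR (- n) ^+ 2.
  by have -> : expR M = expR (M / 2) ^+ 2; [rewrite expr2 -expRD; congr expR; lra|ring].
have e0 := expR_gt0 n; have ev := expRVN n.
have c1 : 0 <= 1 - c by rewrite subr_ge0 cos_le1.
have ss : (expR n / 4) * (expR n / 4) <= s1 * s2.
  by apply: ler_pM => //; lra.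
have h3 : s1 * s2 * (1 - c) <= expR M by nra.
have h4 : (expR n / 4) * (expR n / 4) * (1 - c) <= expR M.
  by apply: le_trans h3; apply: ler_wpM2r.
have en0 := expR_gt0 (- n).
have -> : 1 - c = (expR n / 4) * (expR n / 4) * (1 - c) * (16 * expR (- n) ^+ 2).
  have -> : expR n / 4 * (expR n / 4) * (1 - c) * (16 * expR (- n) ^+ 2) =
    (expR n * expR (- n)) ^+ 2 * (1 - c) by field.
  by rewrite ev expr1n mul1r.
have -> : 16 * expR M * expR (- n) ^+ 2 = expR M * (16 * expR (- n) ^+ 2) by ring.
by apply: ler_wpM2r => //; rewrite mulr_ge0 ?sqr_ge0.
Qed.

End Angles.

(** * Injectivity of point-pushing *)

Section SquareHomotopy.
Context {R : realType} {S : topologicalType} {p : S}.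
Local Notation I := (unit_interval R).

(** The two ways around the boundary of a square are homotopic by convexity of the
    square: [be] and [al] are the coordinates of one boundary path, [al] and [be]
    those of the other. *)
Lemma square_homotopic (H : I * I -> S) (l0 l1 m0 m1 : loop R p) :
  continuous H ->
  (forall t, H (zero, t) = l0 t) -> (forall t, H (one, t) = l1 t) ->
  (forall t, H (t, zero) = m0 t) -> (forall t, H (t, one) = m1 t) ->
  homotopic (concat l0 m1) (concat m0 l1).
Proof.
move=> cH Hl0 Hl1 Hm0 Hm1.
pose be (t : I) : R := set_val (clamp (0 + 2 * set_val t)).
pose al (t : I) : R := set_val (clamp (-1 + 2 * set_val t)).
have cI : continuous (@id I) by move=> x; exact: cvg_id.
have cb : continuous be.
  exact: continuous_compT (@continuous_reparam R I 0 2 id cI) continuous_set_val.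
have ca : continuous al.
  exact: continuous_compT (@continuous_reparam R I (-1) 2 id cI) continuous_set_val.
pose mix (f g : I -> R) (st : I * I) : R :=
  f st.2 + set_val st.1 * (g st.2 - f st.2).
have cmix f g : continuous f -> continuous g -> continuous (mix f g).
  move=> cf cg x; have c2 h : continuous h -> continuous (fun st : I * I => h st.2 : R).
    by move=> ch; exact: continuous_compT (@continuous_snd _ _) ch.
  apply: cvgD; first exact: c2.
  apply: cvgM; last by apply: cvgB; exact: c2.
  exact: (continuous_compT (@continuous_fst _ _) continuous_set_val).
exists (fun st => H (clamp (mix al be st), clamp (mix be al st))); split.
- apply: continuous_compT cH; apply: continuous_pair.
    exact: continuous_compT (cmix _ _ ca cb) continuous_clamp.
  exact: continuous_compT (cmix _ _ cb ca) continuous_clamp.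
- move=> t; rewrite /mix /= val_zero val_one !mul0r !mul1r !addr0.
  rewrite [al t + _]addrC subrK [be t + _]addrC subrK /al /be !set_val_clampK.
  rewrite /concat /= /mk_path /concat_fun.
  case: (leP (set_val t) (1/2)) => ht.
    by rewrite (@clamp_le0 _ (-1 + _)) ?Hl0 ?Hm0//; lra.
  by rewrite (@clamp_ge1 _ (0 + _)) ?Hl1 ?Hm1//; lra.
- move=> s; rewrite /mix /al /be /= val_zero val_one.
  rewrite mulr0 mulr1 !addr0 !add0r.
  rewrite (@clamp_le0 _ (-1)); last lra.
  rewrite (@clamp_le0 _ 0)// (@clamp_ge1 _ 2); last lra.
  rewrite (@clamp_ge1 _ (-1 + 2)); last lra.
  rewrite val_zero val_one !subrr !mulr0 !addr0 clamp_le0// clamp_ge1//.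
  by rewrite Hl0 Hl1 path_zero path_one.
Qed.

End SquareHomotopy.

Section PointPush.
Local Open Scope quotient_scope.
Context {R : realType} {S : topologicalType} {p : S} {O : set (R * R -> S)}.
Local Notation I := (unit_interval R).
Implicit Types (f g : homeo O [set p]) (a l : loop R p).

Lemma homeo_loop_continuous f l : continuous (f \o l).
Proof. exact: continuous_compT (@cts_fun _ _ l) (@homeo_continuous _ _ _ _ f). Qed.

Lemma homeo_loop0 f l : (f \o l) zero = p.
Proof. by rewrite /= path_zero homeo_fix. Qed.

Lemma homeo_loop1 f l : (f \o l) one = p.
Proof. by rewrite /= path_one homeo_fix. Qed.

Definition homeo_loop f l : loop R p :=
  mk_path (@homeo_loop_continuous f l) (homeo_loop0 f l) (homeo_loop1 f l).

Lemma isotopic_homeo_loop f g l :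
  isotopic f g -> homotopic (homeo_loop f l) (homeo_loop g l).
Proof.
move=> [F [cF F0 F1]]; exists (fun st => F st.1 (l st.2)); split.
- apply: (@continuous_compT (I * I)%type (I * S)%type S (fun st => (st.1, l st.2)) _ _ cF).
  apply: continuous_pair; first exact: continuous_fst.
  exact: continuous_compT (@continuous_snd _ _) (@cts_fun _ _ l).
- by move=> t; rewrite F0 F1.
- by move=> s /=; rewrite path_zero path_one homeo_fix.
Qed.

(** The square swept out by the loop [l] during the isotopy shows that pushing
    along [a] acts as conjugation by [a]. *)
Lemma point_push_conj a m : point_push a m -> exists2 f, \pi_(mcg O [set p]) f = m &
  forall l, homotopic (concat (homeo_loop f l) a) (concat a l).
Proof.
move=> [f [fm [F [cF F0 F1 Fp]]]]; exists f => // l.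
apply: (square_homotopic (H := fun st => F st.1 (l st.2))).
- apply: (@continuous_compT (I * I)%type (I * S)%type S (fun st => (st.1, l st.2)) _ _ cF).
  apply: continuous_pair; first exact: continuous_fst.
  exact: continuous_compT (@continuous_snd _ _) (@cts_fun _ _ l).
- by move=> t; rewrite F0.
- by move=> t; rewrite F1.
- by move=> t; rewrite path_zero Fp.
- by move=> t; rewrite path_one Fp.
Qed.

Lemma point_pushing_central (iota : pi1 R p -> mcg O [set p]) x y :
  point_pushing iota -> iota x = iota y ->
  forall z, (z * (x^-1 * y) = (x^-1 * y) * z)%g.
Proof.
move=> hi; rewrite -(reprK x) -(reprK y) => E z; rewrite -(reprK z).
have [f fm fc] := point_push_conj (hi (repr x)).
have [g gm gc] := point_push_conj (hi (repr y)).
have fg : isotopic f g by apply/mcg_eqP; rewrite fm gm.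
have /pi1_eqP e := isotopic_homeo_loop (repr z) fg.
have /pi1_eqP := fc (repr z); have /pi1_eqP := gc (repr z).
rewrite -!pi1_mulE e !reprK.
set w : pi1 R p := \pi_(pi1 R p) _.
change ((w * y = y * z)%g -> (w * x = x * z)%g -> (z * (x^-1 * y) = (x^-1 * y) * z)%g).
move=> ey ex; rewrite -mulgA -ey !mulgA; congr (_ * y)%g.
by apply: (mulgI x); rewrite !mulgA mulgV mul1g -ex mulgK.
Qed.

End PointPush.

Section CenterTrivial.
Context {R : realType} {S : topologicalType} {p : S}.
Local Notation H2 := (set_type (upper_half_plane R)).
Variables (q : H2 -> S) (pt : H2) (B : seq (pi1 R p)) (G : H2 -> pi1 R p).

(** A central element translates every point of the group by the same word
    distance, so that its deck transformation has bounded displacement. *)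
Lemma center_trivial : hyperbolic_structure q -> q pt = p ->
  deck_equivariant q pt G -> quasi_isometry hyp_dist (word_dist R B) G ->
  forall c : pi1 R p, (forall x, x * c = c * x)%g -> c = 1%g.
Proof.
move=> [cq iq] qpt eG [K [C [K1 C0 qi _]]] c cc.
have [D DD] := exists_deck_action cq c qpt.
have GD z : G (D z) = (c * G z)%g by exact: (eG _ _ DD).
have K0 : 0 < K by lra.
have disp z : hyp_dist (D z) z <= K * ((word_length B c^-1)%:R + C).
  have /andP[h _] := qi (D z) z; rewrite GD in h.
  have e : ((c * G z)^-1 * G z = c^-1)%g.
    by apply: (mulgI (c * G z)%g); rewrite mulgA mulgV mul1g -cc mulgK.
  move: h; rewrite /word_dist e => h.
  by rewrite -ler_pdivrMl// mulrC; lra.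
have Did := bounded_displacement_id (iq _ DD.1) disp.
by have := GD pt; rewrite Did -{1}[G pt]mul1g => /mulIg.
Qed.

End CenterTrivial.

(** * Counting group elements and covering sets of directions *)

Section Counting.
Context {H : groupType}.
Implicit Types (A : seq H) (x : H).

(** The unit is a letter, so that shorter words count among the longer ones. *)
Definition letters A : seq H := 1%g :: A ++ [seq a^-1%g | a <- A].

Fixpoint words A n : seq H :=
  if n is m.+1 then [seq (a * b)%g | a <- letters A, b <- words A m] else [:: 1%g].

Lemma size_words A n : size (words A n) = (size (letters A) ^ n)%N.
Proof.
elim: n => // n IH; rewrite (_ : words A n.+1 =
  [seq (a * b)%g | a <- letters A, b <- words A n]) //.
by rewrite size_allpairs IH expnS.
Qed.

Lemma mul_words A n a b :
  a \in letters A -> b \in words A n -> (a * b)%g \in words A n.+1.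
Proof.
move=> aA bn; rewrite (_ : words A n.+1 =
  [seq (a * b)%g | a <- letters A, b <- words A n]) //.
by apply/allpairsP; exists (a, b).
Qed.

Lemma words_monotone A m n : (m <= n)%N -> {subset words A m <= words A n}.
Proof.
move=> /subnK <-; elim: (n - m)%N => // k IH x xm; rewrite addSn -[x]mul1g.
by apply: mul_words; [exact: mem_head|exact: IH].
Qed.

Lemma is_word_words A n x : is_word A n x -> x \in words A n.
Proof.
move=> [w [<- wA ->]]; elim: w wA => [|a w IH] wA; first by rewrite mem_head.
apply: mul_words.
- rewrite inE mem_cat; apply/orP; right; apply/orP.
  have /orP[aA|aA] := wA a (mem_head _ _); [by left|right].
  by apply/mapP; exists a^-1%g => //; rewrite invgK.
- by apply: IH => b bw; apply: wA; rewrite inE bw orbT.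
Qed.

Lemma ball_words A n x : generates A -> (word_length A x <= n)%N -> x \in words A n.
Proof.
move=> gA xn; apply: (words_monotone xn); apply: is_word_words.
rewrite /word_length; case: pselect => [ex|[]]; last first.
  by have [m mx] := gA x; exists m; apply/asboolP.
by case: ex_minnP => m /asboolP.
Qed.

End Counting.

Section Directions.
Context {R : realType}.
Local Notation mu := (@lebesgue_measure R).

(** Three intervals are needed because angles close to 0 and to [2 * pi] are close
    to each other. *)
Lemma arc_cover (E : set R) (e : R) : 0 <= e ->
  (forall t, E t -> t \in `[0, 2 * pi[) ->
  (forall t t', E t -> E t' -> 1 - cos (t - t') <= e ^+ 2) ->
  exists F : set R, [/\ measurable F, E `<=` F & (mu F <= (18 * e)%:E)%E].
Proof.
move=> e0 E2 Ec.
have [->|/set0P[t0 Et0]] := eqVneq E set0.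
  exists set0; split => //; rewrite measure0 lee_fin; lra.
pose J (c : R) : set R := [set` `[c - 3 * e, c + 3 * e]].
have mJ c : measurable (J c) by exact: measurable_itv.
have muJ c : (mu (J c) <= (6 * e)%:E)%E.
  rewrite lebesgue_measure_itv /= lte_fin; case: ifP => _; last by rewrite lee_fin; lra.
  by rewrite -EFinD lee_fin; lra.
exists ((J t0 `|` J (t0 + 2 * pi)) `|` J (t0 - 2 * pi)); split.
- by do !apply: measurableU.
- move=> t Et.
  have := @angle_close R (t - t0) e e0 _ (Ec _ _ Et Et0).
  have := E2 _ Et; have := E2 _ Et0; rewrite !in_itv/= => /andP[? ?] /andP[? ?].
  case; first by rewrite ler_norml; apply/andP; split; lra.
  + by rewrite ler_norml => /andP[? ?]; left; left; rewrite /J/= in_itv/=; apply/andP; split; lra.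
  + by rewrite ler_norml => /andP[? ?]; left; right; rewrite /J/= in_itv/=; apply/andP; split; lra.
  + by rewrite ler_norml => /andP[? ?]; right; rewrite /J/= in_itv/=; apply/andP; split; lra.
- apply: le_trans; first by apply: measureU2; [apply: measurableU|]; exact: mJ.
  have -> : 18 * e = 6 * e + 6 * e + 6 * e by ring.
  rewrite !EFinD; apply: leeD; last exact: muJ.
  by apply: le_trans; [apply: measureU2; exact: mJ|apply: leeD; exact: muJ].
Qed.

Lemma finite_cover (T : eqType) (s : seq T) (E : T -> set R) (e : R) : 0 <= e ->
  (forall m, exists F : set R, [/\ measurable F, E m `<=` F & (mu F <= e%:E)%E]) ->
  exists F : set R, [/\ measurable F, forall m, m \in s -> E m `<=` F
    & (mu F <= ((size s)%:R * e)%:E)%E].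
Proof.
move=> e0 h; elim: s => [|m s [F [mF EF muF]]].
  by exists set0; split => //; rewrite measure0 mul0r.
have [F' [mF' EF' muF']] := h m.
exists (F' `|` F); split; first exact: measurableU.
- move=> m'; rewrite inE => /orP[/eqP ->|m's] t Et; first by left; apply: EF'.
  by right; apply: (EF m').
- apply: le_trans; first exact: measureU2.
  by rewrite /= -addn1 natrD mulrDl mul1r addrC EFinD; apply: leeD.
Qed.

Lemma geometric_borel_cantelli (F : nat -> set R) (a r : R) :
  0 <= a -> 0 < r -> r < 1 -> (forall n, measurable (F n)) ->
  (forall n, (mu (F n) <= (a * r ^+ n)%:E)%E) -> mu (lim_sup_set F) = 0%E.
Proof.
move=> a0 r0 r1 mF muF; apply: lim_sup_set_cvg0 => //.
apply: (@le_lt_trans _ _ (a * (1 - r)^-1)%:E); last exact: ltry.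
apply: lime_le; first exact: is_cvg_nneseries.
apply: nearW => n.
apply: (@le_trans _ _ (\sum_(0 <= i < n) (a * r ^+ i)%:E)%E).
  by apply: lee_sum => i _; exact: muF.
rewrite sumEFin lee_fin.
by have := @geometric_le_lim R n a r a0 r0; rewrite (ger0_norm (ltW r0)) => /(_ r1).
Qed.

End Directions.

(** * Linear progress of almost every ray *)

Theorem theorem1p3 (R : realType) (g : nat) (S : topologicalType)
    (O : set (R * R -> S)) (p : S)
    (hg : (2 <= g)%N)
    (hS : closed_oriented_surface O)
    (hgenus : @has_genus R S g)
    (iota : pi1 R p -> mcg O [set p])
    (hiota : point_pushing iota)
    (A : seq (mcg O [set p]))
    (hA : generates A)
    (q : set_type (upper_half_plane R) -> S)
    (hq : hyperbolic_structure q)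
    (pt : set_type (upper_half_plane R))
    (hpt : q pt = p)
    (B : seq (pi1 R p))
    (hB : generates B)
    (G : set_type (upper_half_plane R) -> pi1 R p)
    (hGequiv : deck_equivariant q pt G)
    (hGqi : quasi_isometry hyp_dist (word_dist R B) G)
    (x0 : set_type (upper_half_plane R))
    (hx0 : G x0 = 1%g) :
  exists2 c : R, 0 < c &
    {ae @lebesgue_measure R, forall theta : R, theta \in `[0, 2 * pi[ ->
      forall gamma : R -> set_type (upper_half_plane R),
        geodesic_ray x0 theta gamma ->
        \forall T \near +oo,
          c * T <= word_dist R A (iota (G (gamma 0))) (iota (G (gamma T)))}.
Proof.
pose N := size (letters A); have N0 : (0 < N)%N by [].
have NR : 0 < N%:R :> R by rewrite ltr0n.
exists N%:R^-1; first by rewrite invr_gt0.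
have [K [C [K1 C0 qi _]]] := hGqi.
have iota_inj x y : iota x = iota y -> x = y.
  move=> /(point_pushing_central hiota) xy.
  have := center_trivial hq hpt hGequiv hGqi xy.
  by move=> /(congr1 (fun z => x * z)%g); rewrite mulgA mulgV mul1g mulg1.
have fiber z w : G z = G w -> hyp_dist z w <= K * C.
  move=> zw; have /andP[h _] := qi z w; rewrite zw /word_dist mulVg in h.
  have w1 : word_length B (1%g : pi1 R p) = 0%N.
    rewrite /word_length; case: pselect => // ex; case: ex_minnP => k _ kmin.
    by apply/eqP; rewrite -leqn0; apply: kmin; apply/asboolP; exists [::].
  have K0 : 0 < K by lra.
  by rewrite w1 in h; rewrite -ler_pdivrMl//; lra.
(* [e n] is the bound of [ray_angle_close] at time [n + 1], with [K * C] for
   the diameter of the fibres of [G] *)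
pose e0 := 4 * expR (K * C / 2) : R.
have e00 : 0 < e0 by rewrite mulr_gt0// expR_gt0.
pose e n := e0 * expR (- n.+1%:R) : R.
(* The directions that reach [m] at some time after [n + 1]; the shift by one
   keeps these times at least 1, away from the base-point. *)
pose E n m := [set theta : R | (theta \in `[0, 2 * pi[) /\
  exists gamma T, [/\ geodesic_ray x0 theta gamma, n.+1%:R <= T
    & iota (G (gamma T)) = (iota (G x0) * m)%g]].
have Ecover n m : exists F : set R, [/\ measurable F, E n m `<=` F
    & (lebesgue_measure F <= (18 * e n)%:E)%E].
  apply: arc_cover; first by rewrite mulr_ge0 ?expR_ge0// ltW.
    by move=> t [].
  move=> t t' [_ [g1 [T1 [r1 nT1 i1]]]] [_ [g2 [T2 [r2 nT2 i2]]]].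
  apply: (ray_angle_close r1 r2 _ nT1 nT2); first by rewrite ler1n.
  by apply/fiber/iota_inj; rewrite i1 i2.
have /choice[F FP] : forall n, exists F : set R, [/\ measurable F,
    (forall m, m \in words A (n.+1 %/ N)%N -> E n m `<=` F)
  & (lebesgue_measure F <= ((size (words A (n.+1 %/ N)%N))%:R * (18 * e n))%:E)%E].
  move=> n; apply: finite_cover; first by rewrite !mulr_ge0 ?expR_ge0// ltW.
  exact: Ecover.
pose r := 2 * expR (-1) : R.
have r0 : 0 < r by rewrite mulr_gt0// expR_gt0.
have r1 : r < 1.
  have h : 1 + 1 < expR 1 :> R by apply: expR_gt1Dx; exact: oner_neq0.
  have := expRVN (1 : R); have := expR_gt0 (-1 : R); rewrite /r; nra.
have sizeW n : ((size (words A (n.+1 %/ N)))%:R : R) <= 2 ^+ n.+1.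
  rewrite size_words -natrX ler_nat -/N.
  apply: (@leq_trans ((2 ^ N) ^ (n.+1 %/ N))).
    case: (n.+1 %/ N)%N => // j; rewrite leq_exp2r//.
    by apply: ltnW; exact: ltn_expl.
  by rewrite -expnM leq_pexp2l// mulnC leq_trunc_div.
exists (lim_sup_set F); split.
- apply: bigcap_measurable => // k _; apply: bigcup_measurable => n _.
  by case: (FP n).
- apply: (@geometric_borel_cantelli R F (18 * e0 * r) r) => //.
  + by rewrite !mulr_ge0 ?(ltW e00) ?(ltW r0).
  + by move=> n; case: (FP n).
  + move=> n; case: (FP n) => _ _ h; apply: (le_trans h); rewrite lee_fin.
    have -> : 18 * e0 * r * r ^+ n = 2 ^+ n.+1 * (18 * e n).
      rewrite -mulrA -exprS /r exprMn -expRM_natl mulrN1 /e.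
      by ring.
    by apply: ler_wpM2r; rewrite // !mulr_ge0 ?expR_ge0// ltW.
- move=> theta /= /not_implyP[th /existsNP[gamma /not_implyP[ray nfar]]] n _.
  have g0 : gamma 0 = x0 by case: ray.
  have [T [nT bad]] : exists T : R, n.+1%:R <= T /\
      word_dist R A (iota (G (gamma 0))) (iota (G (gamma T))) < N%:R^-1 * T.
    apply: contrapT => /forallNP h; apply: nfar.
    exists n.+1%:R; split; first exact: num_real.
    move=> T nT; rewrite leNgt; apply/negP => bad.
    by apply: (h T); split => //; exact: ltW.
  have T0 : 0 <= T by apply: le_trans nT; exact: ler0n.
  have /andP[tT Tt] := truncn_itv T0.
  set k := Num.truncn T in tT Tt.
  have nk : (n < k)%N by rewrite truncn_gt_nat.
  have kE : k = k.-1.+1 by rewrite prednK// (leq_trans _ nk).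
  exists k.-1; first by rewrite /= -ltnS -kE.
  case: (FP k.-1) => _ Fsub _.
  pose m := ((iota (G (gamma 0)))^-1 * iota (G (gamma T)))%g.
  apply: (Fsub m).
    rewrite -kE; apply: ball_words => //; rewrite leq_divRL//.
    rewrite -ltnS -(ltr_nat R) natrM; apply: le_lt_trans Tt.
    by move: bad; rewrite /word_dist -/m ltr_pdivlMl// mulrC => /ltW.
  split => //; exists gamma, T; split => //; first by rewrite -kE.
  by rewrite /m g0 mulgA mulgV mul1g.
Qed.
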